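(* Let $V=\mathrm{Sym}(3,\mathbb{C})$ be the space of complex symmetric $3\times 3$ matrices, with $G=\mathrm{SL}(3,\mathbb{C})$ acting by $g\cdot x=gxg^t$, and let $A(3)=\mathbb{C}[V\oplus V\oplus V]^G$ be the algebra of polynomial functions on $V\oplus V\oplus V$ invariant under the diagonal action of $G$. Then the Poincaré series of $A(3)$ is $$P(t)=\frac{1+t^6+t^{12}}{(1-t^3)^{10}}.$$
   Context: The algebra $A(3)$ is graded by the degree of polynomials, $A(3)=\bigoplus_{n\ge 0}A_n(3)$, and its Poincaré series is $P(t)=\sum_{n\ge 0}\dim_{\mathbb{C}}(A_n(3))\,t^n$. *)

(* Defs.v *)
From HB Require Import structures.
From mathcomp Require Import all_boot all_order all_algebra.
From mathcomp Require Import boolp reals complex mpoly.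

Set Implicit Arguments.
Unset Strict Implicit.
Unset Printing Implicit Defensive.

Import Order.TTheory GRing.Theory Num.Theory.
Local Open Scope ring_scope.

(* Formal power series over a field: the sequence of coefficients, with the
   Cauchy product. *)
Section FormalPowerSeries.
Variable F : fieldType.

Definition fps := nat -> F.

Definition fps_of_poly (p : {poly F}) : fps := fun n => p`_n.

Definition fps_mul (a b : fps) : fps :=
  fun n => \sum_(i < n.+1) a i * b (n - i)%N.

(* The first n coefficients of the inverse b of a (for a 0 != 0), obtained by
   solving \sum_(i <= m) b i * a (m - i) = (m == 0) for b m. *)
Fixpoint fps_inv_seq (a : fps) (n : nat) : seq F :=
  if n is m.+1 then
    let s := fps_inv_seq a m in
    rcons s (((m == 0%N)%:R - \sum_(i < m) s`_i * a (m - i)%N) / a 0%N)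
  else [::].

Definition fps_inv (a : fps) : fps := fun n => (fps_inv_seq a n.+1)`_n.

Definition fps_div (a b : fps) : fps := fps_mul a (fps_inv b).

Lemma size_fps_inv_seq a n : size (fps_inv_seq a n) = n.
Proof. by elim: n => //= n IHn; rewrite size_rcons IHn. Qed.

Lemma nth_fps_inv_seq a n i : (i < n)%N -> (fps_inv_seq a n)`_i = fps_inv a i.
Proof.
elim: n => // n IHn; rewrite ltnS leq_eqVlt => /predU1P[-> // | lt_in].
by rewrite -IHn //= nth_rcons size_fps_inv_seq lt_in.
Qed.

Lemma fps_mulVr a : a 0%N != 0 -> fps_mul (fps_inv a) a = fps_of_poly 1.
Proof.
move=> a0; apply/funext => n.
rewrite /fps_mul /fps_of_poly coef1 big_ord_recr /= subnn.
rewrite {2}/fps_inv /= nth_rcons size_fps_inv_seq ltnn eqxx divfK //.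
rewrite addrC -addrA [X in _ + X](_ : _ = 0) ?addr0 // addrC; apply/eqP.
rewrite subr_eq0; apply/eqP; apply: eq_bigr => i _.
by rewrite nth_fps_inv_seq.
Qed.

End FormalPowerSeries.

(* A subset of a finite-dimensional space closed under linear combinations is
   (the set of elements of) a {vspace _}. *)
Lemma submod_vspace (K : fieldType) (W : vectType K) (P : W -> Prop) :
    P 0 -> (forall (c : K) u v, P u -> P v -> P (c *: u + v)) ->
  exists U : {vspace W}, forall v, v \in U <-> P v.
Proof.
move=> P0 Plin.
pose Q d := `[< exists U : {vspace W}, (forall v, v \in U -> P v)
                                        /\ \dim U = d >].
have exQ : exists d, Q d.
  exists 0%N; apply/asboolP; exists 0%VS; split; last exact: dimv0.
  by move=> v; rewrite memv0 => /eqP ->.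
have ubQ d : Q d -> (d <= \dim {:W})%N.
  by move=> /asboolP[U [_ <-]]; apply: dimvS; apply: subvf.
have [d /asboolP[U [UP dU]] dmax] := ex_maxnP exQ ubQ.
exists U => v; split=> [/UP // | Pv].
have: Q (\dim (U + <[v]>)%VS).
  apply/asboolP; exists (U + <[v]>)%VS; split=> // w.
  move=> /memv_addP[u uU [_ /vlineP[c ->] ->]].
  by rewrite addrC; apply: Plin => //; apply: UP.
move=> /dmax; rewrite -dU => le_dim.
have sUUv : (U <= U + <[v]>)%VS by exact: addvSl.
have /eqP -> : U == (U + <[v]>)%VS by rewrite eqEdim sUUv.
by apply: (subvP (addvSr U <[v]>%VS)); apply: memv_line.
Qed.

(* Entries (i, j), i <= j, of a symmetric 3 x 3 matrix: the linear coordinates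
   on Sym(3). *)
Definition sym_entry : 6.-tuple ('I_3 * 'I_3) :=
  [tuple (inord 0, inord 0); (inord 0, inord 1); (inord 0, inord 2);
         (inord 1, inord 1); (inord 1, inord 2); (inord 2, inord 2)].

Lemma sym_entry_uniq : uniq sym_entry.
Proof. by rewrite /= !inE !xpair_eqE -!val_eqE /= !inordK. Qed.

Lemma sym_entry_le e : ((tnth sym_entry e).1 <= (tnth sym_entry e).2)%N.
Proof.
suff /allP : all (fun ij : 'I_3 * 'I_3 => (ij.1 <= ij.2)%N) sym_entry.
  by apply; exact: mem_tnth.
by rewrite /= !inordK.
Qed.

Lemma sym_entryP (i j : 'I_3) :
  (i <= j)%N -> exists e, tnth sym_entry e = (i, j).
Proof.
move=> le_ij; suff /tnthP[e ->] : (i, j) \in sym_entry by exists e.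
rewrite -(inord_val i) -(inord_val j).
case: i j le_ij => [[|[|[]]] //= _] [[|[|[]]] //= _] _;
  by rewrite !inE eqxx ?orbT.
Qed.

Section Invariants.
Variable K : fieldType.

(* The 18 coordinates of a triple (x 0, x 1, x 2) of symmetric matrices. *)
Definition coords (x : 'I_3 -> 'M[K]_3) : 'I_18 -> K :=
  fun i => (mxvec (\matrix_(k < 3, e < 6)
    x k (tnth sym_entry e).1 (tnth sym_entry e).2) : 'rV[K]_18) 0 i.

Definition sym_act (g x : 'M[K]_3) : 'M[K]_3 := g *m x *m g^T.

(* Over an infinite field, {mpoly K[18]} is the algebra of polynomial functions
   on Sym(3) (+) Sym(3) (+) Sym(3), p having value p.@[coords x] at x. *)
Definition SL3_invariant (p : {mpoly K[18]}) : Prop :=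
  forall (g : 'M[K]_3) (x : 'I_3 -> 'M[K]_3),
    \det g = 1 -> (forall k, x k \is symmetricmx) ->
    p.@[coords (fun k => sym_act g (x k))] = p.@[coords x].

Lemma coordsE x (k : 'I_3) (e : 'I_6) :
  coords x (mxvec_index k e) = x k (tnth sym_entry e).1 (tnth sym_entry e).2.
Proof. by apply: etrans (mxvecE _ _ _) _; rewrite mxE. Qed.

(* coords is a bijection from triples of symmetric matrices onto K^18. *)
Lemma coords_inj (x y : 'I_3 -> 'M[K]_3) :
    (forall k, x k \is symmetricmx) -> (forall k, y k \is symmetricmx) ->
  coords x =1 coords y -> x =1 y.
Proof.
move=> sx sy exy k; apply/matrixP.
have sxy (z : 'M[K]_3) : z \is symmetricmx -> forall i j, z i j = z j i :> K.
  by move=> /is_hermitianmxP sz i j; rewrite {1}sz expr0 scale1r !mxE.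
have le_xy (i j : 'I_3) : (i <= j)%N -> x k i j = y k i j.
  move=> /sym_entryP[e ee].
  by have := exy (mxvec_index k e); rewrite !coordsE ee.
move=> i j; case: (leqP i j) => [/le_xy // | /ltnW /le_xy].
by rewrite sxy // => ->; rewrite sxy.
Qed.

Lemma coords_surj (v : 'I_18 -> K) :
  exists2 x : 'I_3 -> 'M[K]_3, (forall k, x k \is symmetricmx) & coords x =1 v.
Proof.
pose e (i j : 'I_3) : 'I_6 :=
  inord (index (if (i <= j)%N then (i, j) else (j, i)) sym_entry).
exists (fun k : 'I_3 => \matrix_(i, j) v (mxvec_index k (e i j))) => [k | i].
  apply/is_hermitianmxP; rewrite expr0 scale1r; apply/matrixP => i j.
  rewrite !mxE; suff -> : e i j = e j i by [].
  by rewrite /e; case: ltngtP => // /val_inj ->.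
case/(@mxvec_indexP 3 6): i => k a; rewrite coordsE mxE.
suff -> : e (tnth sym_entry a).1 (tnth sym_entry a).2 = a by [].
rewrite /e sym_entry_le -surjective_pairing (tnth_nth (ord0, ord0)) index_uniq.
- exact: inord_val.
- by rewrite size_tuple.
- exact: sym_entry_uniq.
Qed.

Lemma A3_vspace n : exists U : {vspace dhomog 18 K n},
  forall p, p \in U <-> SL3_invariant (mpoly_of_dhomog p).
Proof.
apply: submod_vspace => [|c p q Ip Iq] g x dg sx; first by rewrite !meval0.
by rewrite linearP /= !mevalD !mevalZ Ip // Iq.
Qed.

(* The degree n component of the algebra of invariants; see mem_A3. *)
Definition A3 (n : nat) : {vspace dhomog 18 K n} := projT1 (cid (A3_vspace n)).

Lemma mem_A3 n (p : dhomog 18 K n) :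
  p \in A3 n <-> SL3_invariant (mpoly_of_dhomog p).
Proof. exact: (projT2 (cid (A3_vspace n))). Qed.

Definition poincare_series_A3 : fps rat := fun n => (\dim (A3 n))%:R.

End Invariants.

(* Main.v *)
Require Import Defs.
From HB Require Import structures.
From Stdlib Require BinNat Nnat.
From mathcomp Require Import all_boot all_order all_algebra.
From mathcomp Require Import reals complex boolp mpoly.
From mathcomp Require Import ring lra zify.

Set Implicit Arguments.
Unset Strict Implicit.
Unset Printing Implicit Defensive.

Import Order.TTheory GRing.Theory Num.Theory.
Local Open Scope ring_scope.

(** SL(3) is generated by transvections, so a polynomial is invariant if and only
    if it is killed by the derivations through which the off-diagonal matrix
    units act ([SL3_invariant_gl_der]).  The invariants of degree n thus form the
    trivial isotypic part of a finite-dimensional gl(3)-module, and their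
    dimension is an alternating sum of dimensions d of weight spaces, namely
      d(0,0,0) - d(1,-1,0) - d(1,0,-1) + d(2,-1,-1) + d(1,1,-2) - d(2,0,-2),
    as in the Weyl character formula ([dim_inv_space]).  The vectors killed by
    the first raising operator are counted by a surjectivity statement for sl(2)
    ([dim_hw2]); the two remaining raising operators give a complex of three such
    spaces, with the invariants as kernel of the first map.  The Casimir operator
    is homotopic to zero on this complex and injective on its last two terms, hence
    the complex is exact there and an Euler characteristic gives the dimension.

    The weight spaces have bases of monomials.  Sorting the monomials by their
    degrees in the six entries of a symmetric matrix, where each degree k is met
    'C(k + 2, 2) times because there are three copies of the matrix, one finds
    no weight zero unless n = 3 j, and then the six dimensions are sums of twelve
    functions of j, the blocks ([weight_counts]).  A block is a sum of values of
    a polynomial over the lattice points of a polytope that splits into two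
    simplices ([region_split]); restricted to a parity class of j it is therefore
    a polynomial of degree at most 15 ([pol_seq_block]).  So the equality of the
    alternating sum with 'C(j + 9, 9) + 'C(j + 7, 9) + 'C(j + 5, 9) for all j
    ([blocks_identity]) follows from its verification for j < 34, which is done
    by computation ([blocks_small]).  These numbers are the coefficients of the
    rational function in the theorem, read in the variable t^3. *)

(** * Weight multiplicities and invariants of gl(3)-modules *)

Notation o0 := (@Ordinal 3 0 isT).
Notation o1 := (@Ordinal 3 1 isT).
Notation o2 := (@Ordinal 3 2 isT).

(** Reduces an identity between vectors to one between scalars, which [ring] can prove. *)
Lemma vect_scalarP (K : fieldType) (W : vectType K) (u v : W) :
  (forall phi : {scalar W}, phi u = phi v) -> u = v.
Proof.
move=> uv; rewrite (coord_vbasis (memvf u)) (coord_vbasis (memvf v)).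
by apply: eq_bigr => i _; rewrite (uv (coord (vbasis fullv) i)).
Qed.

(** The operators [e i j] satisfy the relations of the matrix units of gl(3). The eigenvalues
    of the diagonal ones are natural numbers up to a common shift, and bounded. *)
Section GL3.
Variables (K : numFieldType) (W : vectType K) (e : 'I_3 -> 'I_3 -> 'End(W)).
Hypothesis eC : forall i j k l v, e i j (e k l v) =
  e k l (e i j v) + (j == k)%:R *: e i l v - (l == i)%:R *: e k j v.
Hypothesis e_bounded : exists m0 : K, exists N : nat, forall i (a : K) v,
  v != 0 -> e i i v = a *: v -> exists2 k : nat, (k <= N)%N & a + m0 = k%:R.

Definition has_weight (a : 'I_3 -> K) (v : W) := forall k, e k k v = a k *: v.

Lemma has_weight_shift a v i j :
  has_weight a v -> has_weight (fun k => a k + (k == i)%:R - (k == j)%:R) (e i j v).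
Proof.
move=> av k; rewrite eC av linearZ /= !scalerBl !scalerDl.
congr (_ + _ - _); first by case: eqP => [->|_]; rewrite ?scale0r.
by rewrite eq_sym; case: eqP => [->|_]; rewrite ?scale0r.
Qed.

Lemma has_weight_iter a v i j r : has_weight a v ->
  has_weight (fun k => a k + r%:R * ((k == i)%:R - (k == j)%:R)) (iter r (e i j) v).
Proof.
move=> av; elim: r => [|r IHr] k /=; first by rewrite mul0r addr0.
by rewrite (has_weight_shift i j IHr) -natr1; congr (_ *: _); ring.
Qed.

(** Every application of [e i j] adds 1 to the eigenvalue of [e i i], which is bounded. *)
Lemma climb a v i j : i != j -> has_weight a v -> v != 0 ->
  exists r, iter r (e i j) v != 0 /\ e i j (iter r (e i j) v) = 0.
Proof.
move=> ij av v0; have [m0 [N bnd]] := e_bounded.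
have wt r : e i i (iter r (e i j) v) = (a i + r%:R) *: iter r (e i j) v.
  by rewrite (has_weight_iter i j r av) eqxx (negPf ij) subr0 mulr1.
have [k kN ak] := bnd i _ v v0 (av i).
have : exists r, iter r (e i j) v == 0.
  exists N.+1; apply/negPn/negP => vN.
  have [k' k'N] := bnd i _ _ vN (wt N.+1).
  rewrite addrAC ak -natrD => /eqP; rewrite eqr_nat => /eqP kk'.
  by move: k'N; rewrite -kk' addnS ltnNge leq_addl.
move=> /ex_minnP[[|r] /eqP rv rmin]; first by move: v0; rewrite (rv : v = 0) eqxx.
exists r; split=> //; apply/negP => /rmin; by rewrite ltnn.
Qed.

(** The Casimir operator of the copy of gl supported by the indices in [S]. *)
Definition casimir (S : pred 'I_3) (v : W) := \sum_(i | S i) \sum_(j | S j) e i j (e j i v).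

Lemma casimirC (S : pred 'I_3) k l v : S k -> S l -> casimir S (e k l v) = e k l (casimir S v).
Proof.
move=> Sk Sl; rewrite /casimir linear_sum.
have E i j : e i j (e j i (e k l v)) - e k l (e i j (e j i v)) =
    (i == k)%:R *: e i j (e j l v) - (l == j)%:R *: e i j (e k i v)
    + (j == k)%:R *: e i l (e j i v) - (l == i)%:R *: e k j (e j i v).
  rewrite (eC j i k l) !linearB !linearD !linearZ /= (eC i j k l (e j i v)).
  by apply: vect_scalarP => phi; rewrite !(linearD, linearN, linearZ) /=; ring.
apply/eqP; rewrite -subr_eq0 -sumrB; apply/eqP.
under eq_bigr => i _ do rewrite linear_sum -sumrB.
under eq_bigr => i _ do under eq_bigr => j _ do rewrite E.
have pick (F : 'I_3 -> W) (m : 'I_3) : S m -> \sum_(i | S i) (i == m)%:R *: F i = F m.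
  move=> Sm; rewrite (bigD1 m) //= eqxx scale1r big1 ?addr0 // => i /andP[_ /negPf ->].
  by rewrite scale0r.
have pick' (F : 'I_3 -> W) (m : 'I_3) : S m -> \sum_(i | S i) (m == i)%:R *: F i = F m.
  by move=> Sm; rewrite -[RHS](pick _ _ Sm); apply: eq_bigr => i _; rewrite eq_sym.
under eq_bigr => i _.
  rewrite !big_split /= !sumrN pick' // pick //.
  rewrite -[X in X - _ + _ - _]scaler_sumr -[X in _ - X]scaler_sumr.
  over.
rewrite !big_split /= !sumrN pick // pick' //.
by rewrite subrK subrr.
Qed.

Lemma casimirC_iter (S : pred 'I_3) k l r v : S k -> S l ->
  casimir S (iter r (e k l) v) = iter r (e k l) (casimir S v).
Proof. by move=> Sk Sl; elim: r => //= r IHr; rewrite casimirC // IHr. Qed.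

(** Climb from [v] to a vector [w] killed by [e i j], of weight [b]. The Casimir operator of
    the indices i and j has the value [b i ^+ 2 + b j ^+ 2 + b i - b j] at [w] and the value
    [a i ^+ 2 + a j ^+ 2 - (a i - a j)] at [v]. They have to agree, but the former is larger. *)
Lemma sl2_raise_lower_inj a v i j n : i != j -> has_weight a v ->
  a i - a j = n.+1%:R -> e i j (e j i v) = 0 -> v = 0.
Proof.
move=> ij av aij efv; apply/eqP/negPn/negP => v0.
have [r [vr0 evr]] := climb ij av v0.
pose S := pred2 i j.
have Si : S i by rewrite /S /= eqxx.
have Sj : S j by rewrite /S /= eqxx orbT.
have sumS (F : 'I_3 -> W) : \sum_(k | S k) F k = F i + F j.
  rewrite (bigD1 i) //= (bigD1 j) //= ?eqxx ?orbT 1?eq_sym ?ij //.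
  rewrite big1 ?addr0 // => k; rewrite /S /=.
  by case: (k == i); case: (k == j).
have casE (b : 'I_3 -> K) u : has_weight b u ->
    casimir S u = (b i ^+ 2 + b j ^+ 2) *: u + e i j (e j i u) + e j i (e i j u).
  move=> bu; rewrite /casimir !sumS !bu !linearZ /= !bu.
  by apply: vect_scalarP => phi; rewrite !(linearD, linearN, linearZ) /=; ring.
have C1 : casimir S v = (a i ^+ 2 + a j ^+ 2 - n.+1%:R) *: v.
  rewrite (casE _ _ av) (eC j i i j) efv !eqxx !av -aij.
  by apply: vect_scalarP => phi; rewrite !(linearD, linearN, linearZ, linear0) /=; ring.
have := casimirC_iter r v Si Sj; rewrite C1.
have bw := has_weight_iter i j r av.
rewrite (casE _ _ bw) (eC i j j i) evr linear0 !eqxx !bw !eqxx (negPf ij) [j == i]eq_sym (negPf ij).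
have -> c : iter r (e i j) (c *: v) = c *: iter r (e i j) v.
  by elim: r {vr0 evr bw} => //= r ->; rewrite linearZ.
set w := iter r _ v; set b := a i + _; set c := a j + _.
have -> : (b ^+ 2 + c ^+ 2) *: w + (0 + true%:R *: (b *: w) - true%:R *: (c *: w)) + 0
    = (b ^+ 2 + c ^+ 2 + b - c) *: w.
  by apply: vect_scalarP => phi; rewrite !(linearD, linearN, linearZ, linear0) /=; ring.
have -> : b = a i + r%:R by rewrite /b subr0 mulr1.
have -> : c = a j - r%:R by rewrite /c sub0r mulrN1.
move/eqP; rewrite -subr_eq0 -scalerBl scaler_eq0 (negPf vr0) orbF => /eqP E.
have {E} : n.+1%:R * r%:R + r%:R * r%:R + r%:R + n.+1%:R = 0 :> K.
  rewrite -[RHS](mul0r 2^-1) -{}E -aij; by field.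
move=> E; have := pnatr_eq0 K (n.+1 * r + r * r + r + n.+1)%N.
by rewrite 3!natrD 2!natrM E eqxx addnS.
Qed.

(** [e j i v] is killed by [e i j] and has the weight difference 2 for the opposite choice of
    the raising operator, so it vanishes by the preceding lemma. *)
Lemma sl2_weight0 a v i j : i != j -> has_weight a v -> a i = a j ->
  e i j v = 0 -> e j i v = 0.
Proof.
move=> ij av aij ev; have ji : j != i by rewrite eq_sym.
apply: (@sl2_raise_lower_inj _ _ j i 1 ji (has_weight_shift j i av)).
  by rewrite !eqxx (negPf ij) (negPf ji) aij -[true%:R]/(1 : K) -[false%:R]/(0 : K); ring.
by rewrite (eC i j j i) ev linear0 !eqxx !av aij !scale1r add0r subrr linear0.
Qed.

Definition weight_space (a : 'I_3 -> K) : {vspace W} :=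
  (\bigcap_(k < 3) lker (e k k - a k *: \1%VF))%VS.

Lemma weight_spaceP a v : reflect (has_weight a v) (v \in weight_space a).
Proof.
rewrite /weight_space memvE; apply: (iffP subv_bigcapP) => av k.
  by have := av k isT; rewrite -memvE memv_ker add_lfunE opp_lfunE scale_lfunE id_lfunE subr_eq0 => /eqP.
by move=> _; rewrite -memvE memv_ker add_lfunE opp_lfunE scale_lfunE id_lfunE av subrr.
Qed.

(** Integral weights suffice: only those of the complex below and of vectors above them occur. *)
Definition wt (x y z : int) : 'I_3 -> K := fun k => ([:: x; y; z]`_k)%:~R.

Lemma has_wtP x y z v : has_weight (wt x y z) v <->
  [/\ e o0 o0 v = x%:~R *: v, e o1 o1 v = y%:~R *: v & e o2 o2 v = z%:~R *: v].
Proof.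
split=> [av | [v0 v1 v2]]; first by split; rewrite av.
case=> [[|[|[|//]]] lt].
- by rewrite (_ : Ordinal lt = o0) //; apply: val_inj.
- by rewrite (_ : Ordinal lt = o1) //; apply: val_inj.
by rewrite (_ : Ordinal lt = o2) //; apply: val_inj.
Qed.

Lemma has_wt_shift (x y z x' y' z' : int) v i j : has_weight (wt x y z) v ->
    x' = x + (i == o0)%:Z - (j == o0)%:Z -> y' = y + (i == o1)%:Z - (j == o1)%:Z ->
    z' = z + (i == o2)%:Z - (j == o2)%:Z ->
  has_weight (wt x' y' z') (e i j v).
Proof.
move=> av -> -> ->; have bv := has_weight_shift i j av.
apply/has_wtP; split; rewrite bv /wt /= !intrD !intrN;
  by rewrite ![_ == i]eq_sym ![_ == j]eq_sym.
Qed.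

Lemma casimirE b v : has_weight b v -> e o0 o1 v = 0 -> e o0 o2 v = 0 -> e o1 o2 v = 0 ->
  casimir predT v = (b o0 ^+ 2 + b o1 ^+ 2 + b o2 ^+ 2 + 2 * b o0 - 2 * b o2) *: v.
Proof.
move=> bv v01 v02 v12; rewrite /casimir.
have sum3 (F : 'I_3 -> W) : \sum_i F i = F o0 + F o1 + F o2.
  rewrite !big_ord_recl big_ord0 addr0 -addrA.
  by congr (F _ + (F _ + F _)); apply: val_inj.
rewrite !sum3 (eC o0 o1 o1 o0) (eC o0 o2 o2 o0) (eC o1 o2 o2 o1).
rewrite v01 v02 v12 !bv !linear0 !eqxx !linearZ /= !bv -[true%:R]/(1 : K).
by apply: vect_scalarP => phi; rewrite !(linearD, linearN, linearZ, linear0) /=; ring.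
Qed.

Lemma iter_killed i j k l r v : (forall w, e i j (e k l w) = e k l (e i j w)) ->
  e i j v = 0 -> e i j (iter r (e k l) v) = 0.
Proof. by move=> C v0; elim: r => //= r IHr; rewrite C IHr linear0. Qed.

(** Climbing with [e o1 o2], [e o0 o2] and [e o0 o1], in this order, leads to a highest weight
    vector, on which the Casimir operator is the sum of the squares of the weights plus twice the
    difference of the extreme ones. Climbing does not decrease this difference, so it is
    positive. *)
Lemma casimir_inj x y z v : has_weight (wt x y z) v -> z < x ->
  casimir predT v = 0 -> v = 0.
Proof.
move=> av zx Cv; apply/eqP/negPn/negP => v0.
have [s [v1 v1k]] := climb (isT : o1 != o2) av v0.
have av1 := has_weight_iter o1 o2 s av.
have [r [v2 v2k]] := climb (isT : o0 != o2) av1 v1.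
have av2 := has_weight_iter o0 o2 r av1.
have [t [v3 v3k]] := climb (isT : o0 != o1) av2 v2.
have av3 := has_weight_iter o0 o1 t av2.
set w1 := iter s _ v in v1 v1k av1 v2 v2k av2 v3 v3k av3.
set w2 := iter r _ w1 in v2 v2k av2 v3 v3k av3.
have w2k : e o1 o2 w2 = 0.
  by apply: iter_killed v1k => w; rewrite eC /= !scale0r addr0 subr0.
have w3k02 : e o0 o2 (iter t (e o0 o1) w2) = 0.
  by apply: iter_killed v2k => w; rewrite eC /= !scale0r addr0 subr0.
have w3k12 : e o1 o2 (iter t (e o0 o1) w2) = 0.
  elim: (t) => //= q IHq; rewrite eC IHq linear0 /= scale0r add0r.
  rewrite (iter_killed _ _ v2k) ?scaler0 ?subrr // => w.
  by rewrite eC /= !scale0r addr0 subr0.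
have := casimirE av3 v3k w3k02 w3k12.
rewrite !casimirC_iter // Cv; set w3 := iter t _ w2 in v3 *.
have i0 q i j : iter q (e i j) 0 = 0 by elim: q => //= q ->; rewrite linear0.
rewrite !i0 => /esym/eqP; rewrite scaler_eq0 (negPf v3) orbF.
rewrite /wt /= -[true%:R]/(1 : K) -[false%:R]/(0 : K).
set c := (X in X == 0) => /eqP c0.
pose p : int := x + r%:Z + t%:Z; pose q : int := y + s%:Z - t%:Z.
pose u : int := z - s%:Z - r%:Z.
have : c = (p ^+ 2 + q ^+ 2 + u ^+ 2 + 2 * (p - u))%:~R.
  by rewrite /c /p /q /u; ring.
rewrite c0 => /esym/eqP; rewrite intr_eq0; apply/negP; rewrite gt_eqF //.
apply: ltr_wpDl; first by rewrite !addr_ge0 ?sqr_ge0.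
rewrite pmulr_rgt0 // /p /u; lia.
Qed.

(** The highest weight vectors for the copy of gl(2) supported by the indices 0 and 1. *)
Definition hw2 a : {vspace W} := (weight_space a :&: lker (e o0 o1))%VS.

Lemma hw2P x y z v : reflect (has_weight (wt x y z) v /\ e o0 o1 v = 0) (v \in hw2 (wt x y z)).
Proof.
rewrite memv_cap memv_ker; apply: (iffP andP) => [[/weight_spaceP ? /eqP ?] //|[? ?]].
by split; [apply/weight_spaceP | apply/eqP].
Qed.

(** [e o0 o1] maps the weight space onto the next one, because its composite with [e o1 o0] is
    injective there ([sl2_raise_lower_inj]). *)
Lemma dim_hw2 (x y z : int) (n : nat) : x - y = n ->
  (\dim (hw2 (wt x y z)) + \dim (weight_space (wt (x + 1) (y - 1) z)) =
   \dim (weight_space (wt x y z)))%N.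
Proof.
move=> xy; rewrite -[RHS](limg_ker_dim (e o0 o1)); congr (_ + _)%N; apply/eqP.
have fS : (e o0 o1 @: weight_space (wt x y z) <= weight_space (wt (x + 1) (y - 1) z))%VS.
  apply/subvP => _ /memv_imgP[v /weight_spaceP av ->]; apply/weight_spaceP.
  by apply: (has_wt_shift av) => /=; lia.
rewrite eqn_leq (dimvS fS) andbT.
set U := weight_space _; pose g := (e o0 o1 \o e o1 o0)%VF.
have gS : (e o1 o0 @: U <= weight_space (wt x y z))%VS.
  apply/subvP => _ /memv_imgP[v /weight_spaceP av ->]; apply/weight_spaceP.
  by apply: (has_wt_shift av) => /=; lia.
have <- : \dim (g @: U) = \dim U.
  apply: limg_dim_eq; apply/eqP; rewrite -subv0; apply/subvP => v.
  rewrite memv_cap memv_ker memv0 comp_lfunE => /andP[/weight_spaceP av /eqP gv].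
  apply/eqP/(@sl2_raise_lower_inj _ _ o0 o1 n.+1 isT av _ gv).
  rewrite /wt /= -intrB (_ : _ - _ = n.+2 :> int) ?pmulrn //; lia.
by apply: dimvS; rewrite limg_comp; apply: limgS.
Qed.

Definition inv_space : {vspace W} :=
  (\bigcap_(i < 3) \bigcap_(j < 3 | j != i) lker (e i j))%VS.

Lemma inv_spaceP v : reflect (forall i j, j != i -> e i j v = 0) (v \in inv_space).
Proof.
apply: (iffP idP) => [|H].
  rewrite memvE => /subv_bigcapP H i j ji.
  by have /subv_bigcapP/(_ j ji) := H i isT; rewrite -memvE memv_ker => /eqP.
rewrite memvE; apply/subv_bigcapP => i _; apply/subv_bigcapP => j ji.
by rewrite -memvE memv_ker H.
Qed.

Hypothesis e_trace : forall v, e o0 o0 v + e o1 o1 v + e o2 o2 v = 0.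

(** The complex M0 -> M1 -> M2. A vector v of M1 stands for the gl(2)-equivariant pair
    (v, [e o1 o0 v]) of values of a 1-cochain on the span of [e o0 o2] and [e o1 o2]; this is where
    [d1] and the homotopy [p1] get their second terms. *)
Let M0 := hw2 (wt 0 0 0).
Let M1 := hw2 (wt 1 0 (-1)).
Let M2 := hw2 (wt 1 1 (-2)).
Let d0 : 'End(W) := e o0 o2.
Let d1 : 'End(W) := e o1 o2 - (e o0 o2 \o e o1 o0)%VF.
Let p1 : 'End(W) := e o2 o0 + (e o2 o1 \o e o1 o0)%VF.
Let p2 : 'End(W) := e o2 o1.

Let d1E v : d1 v = e o1 o2 v - e o0 o2 (e o1 o0 v).
Proof. by rewrite /d1 add_lfunE opp_lfunE comp_lfunE. Qed.
Let p1E v : p1 v = e o2 o0 v + e o2 o1 (e o1 o0 v).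
Proof. by rewrite /p1 add_lfunE comp_lfunE. Qed.

Let d0_sub : (d0 @: M0 <= M1)%VS.
Proof.
apply/subvP => _ /memv_imgP[v /hw2P[av v01] ->]; apply/hw2P; split.
  by apply: (has_wt_shift av) => /=; lia.
by rewrite eC v01 linear0 /= !scale0r addr0 subr0.
Qed.

Let d1_sub : (d1 @: M1 <= M2)%VS.
Proof.
apply/subvP => _ /memv_imgP[v /hw2P[av v01] ->]; apply/hw2P; rewrite d1E; split.
  have w1 : has_weight (wt 1 1 (-2)) (e o1 o2 v).
    by apply: (has_wt_shift av) => /=; lia.
  have w2 : has_weight (wt 1 1 (-2)) (e o0 o2 (e o1 o0 v)).
    have w3 : has_weight (wt 0 1 (-1)) (e o1 o0 v).
      by apply: (has_wt_shift av) => /=; lia.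
    by apply: (has_wt_shift w3) => /=; lia.
  by move=> k; rewrite [LHS]linearB /= w1 w2 scalerBr.
rewrite linearB /= (eC o0 o1 o1 o2) (eC o0 o1 o0 o2) (eC o0 o1 o1 o0) v01 !linear0 /=.
have [-> -> _] := (has_wtP _ _ _ _).1 av.
by apply: vect_scalarP => phi; rewrite !(linearD, linearN, linearZ, linear0) /=; ring.
Qed.

Let p1_sub : (p1 @: M1 <= M0)%VS.
Proof.
apply/subvP => _ /memv_imgP[v /hw2P[av v01] ->]; apply/hw2P; rewrite p1E; split.
  have w1 : has_weight (wt 0 0 0) (e o2 o0 v).
    by apply: (has_wt_shift av) => /=; lia.
  have w2 : has_weight (wt 0 0 0) (e o2 o1 (e o1 o0 v)).
    have w3 : has_weight (wt 0 1 (-1)) (e o1 o0 v).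
      by apply: (has_wt_shift av) => /=; lia.
    by apply: (has_wt_shift w3) => /=; lia.
  by move=> k; rewrite [LHS]linearD /= w1 w2 scalerDr.
rewrite linearD /= (eC o0 o1 o2 o0) (eC o0 o1 o2 o1) (eC o0 o1 o1 o0) v01 !linear0 /=.
have [-> -> _] := (has_wtP _ _ _ _).1 av.
by apply: vect_scalarP => phi; rewrite !(linearD, linearN, linearZ, linear0) /=; ring.
Qed.

Let p2_sub : (p2 @: M2 <= M1)%VS.
Proof.
apply/subvP => _ /memv_imgP[v /hw2P[av v01] ->]; apply/hw2P; split.
  by apply: (has_wt_shift av) => /=; lia.
by rewrite eC v01 linear0 /= !scale0r addr0 subr0.
Qed.

Let casimirE9 v : casimir predT v =
  e o0 o0 (e o0 o0 v) + e o1 o1 (e o1 o1 v) + e o2 o2 (e o2 o2 v)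
  + 2 *: e o1 o0 (e o0 o1 v) + 2 *: e o2 o0 (e o0 o2 v) + 2 *: e o2 o1 (e o1 o2 v)
  + 2 *: e o0 o0 v - 2 *: e o2 o2 v.
Proof.
rewrite /casimir.
have sum3 (F : 'I_3 -> W) : \sum_i F i = F o0 + F o1 + F o2.
  rewrite !big_ord_recl big_ord0 addr0 -addrA.
  by congr (F _ + (F _ + F _)); apply: val_inj.
rewrite !sum3 (eC o0 o1 o1 o0) (eC o0 o2 o2 o0) (eC o1 o2 o2 o1).
by apply: vect_scalarP => phi; rewrite !(linearD, linearN, linearZ, linear0) /=; ring.
Qed.

(** Half of the Casimir operator is null-homotopic through [p1] and [p2]. *)
Let homotopy1 v : v \in M1 -> casimir predT v = 2 *: (d0 (p1 v) + p2 (d1 v)).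
Proof.
move=> /hw2P[av v01]; rewrite casimirE9 d1E p1E v01 linear0 /d0 /p2.
have [v0 v1 v2] := (has_wtP _ _ _ _).1 av.
rewrite (linearD (e o0 o2)) (linearB (e o2 o1)) /= (eC o0 o2 o2 o0) (eC o0 o2 o2 o1) (eC o0 o1 o1 o0) v01.
rewrite v0 v1 v2 !linearZ /= v0 v1 v2.
by apply: vect_scalarP => phi; rewrite !(linearD, linearN, linearZ, linear0) /=; ring.
Qed.

Let homotopy2 v : v \in M2 -> casimir predT v = 2 *: d1 (p2 v).
Proof.
move=> /hw2P[av v01]; rewrite casimirE9 d1E v01 linear0 /p2.
have [v0 v1 v2] := (has_wtP _ _ _ _).1 av.
have v10 : e o1 o0 v = 0.
  by apply: (@sl2_weight0 _ v o0 o1 isT av).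
have -> : e o1 o0 (e o2 o1 v) = - e o2 o0 v.
  by rewrite eC v10 linear0 /= scale0r !add0r scale1r.
rewrite linearN /= (eC o1 o2 o2 o1) (eC o0 o2 o2 o0)
   v0 v1 v2 !linearZ /= v0 v1 v2.
by apply: vect_scalarP => phi; rewrite !(linearD, linearN, linearZ, linear0) /=; ring.
Qed.
Let inv_ker : inv_space = (M0 :&: lker d0)%VS.
Proof.
apply/vspaceP => v; rewrite memv_cap memv_ker; apply/inv_spaceP/andP.
  move=> H; have H' i j : j != i -> e i i v = e j j v.
    move=> ji; have ij : i != j by rewrite eq_sym.
    have := eC i j j i v; rewrite (H i j ji) (H j i ij) !linear0 !eqxx !scale1r add0r.
    by move/esym/eqP; rewrite subr_eq0 => /eqP.
  split; last by rewrite /d0 H.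
  apply/hw2P; split; last exact: H.
  have := e_trace v; rewrite (H' o1 o0 isT) (H' o2 o0 isT) => E.
  have e0 : e o0 o0 v = 0.
    have : 3%:R *: e o0 o0 v = 0.
      rewrite -E; apply: vect_scalarP => phi.
      by rewrite !(linearD, linearZ) /=; ring.
    by move/eqP; rewrite scaler_eq0 pnatr_eq0 => /eqP.
  by apply/has_wtP; rewrite (H' o1 o0 isT) (H' o2 o0 isT) e0 !scale0r.
move=> [/hw2P[av v01] /eqP v02].
have [v0 v1 v2] := (has_wtP _ _ _ _).1 av.
have v10 : e o1 o0 v = 0 by apply: (@sl2_weight0 _ v o0 o1 isT av).
have v20 : e o2 o0 v = 0 by apply: (@sl2_weight0 _ v o0 o2 isT av).
have v12 : e o1 o2 v = 0.
  have := eC o1 o0 o0 o2 v; rewrite v10 v02 !linear0 /= scale1r scale0r add0r subr0.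
  by move/esym.
have v21 : e o2 o1 v = 0 by apply: (@sl2_weight0 _ v o1 o2 isT av).
have ord3 (i : 'I_3) : [\/ i = o0, i = o1 | i = o2].
  case: i => [[|[|[|//]]] lt]; [constructor 1 | constructor 2 | constructor 3];
  exact: val_inj.
by move=> i j; case: (ord3 i) => ->; case: (ord3 j) => -> // _.
Qed.

Definition weight_dim (x y z : int) : nat := \dim (weight_space (wt x y z)).
Arguments weight_dim (x y z)%_R.

(** By the homotopy and the injectivity of the Casimir operator the complex is exact at M1 and
    M2, so the dimension of its kernel at M0 is its Euler characteristic, and [dim_hw2]
    expresses the latter in terms of weight spaces. *)
Theorem dim_inv_space :
  (\dim inv_space + weight_dim 1 (-1) 0 + weight_dim 1 0 (-1) + weight_dim 2 0 (-2) =
   weight_dim 0 0 0 + weight_dim 2 (-1) (-1) + weight_dim 1 1 (-2))%N.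
Proof.
have h0 := @dim_hw2 0 0 0 0 erefl; have h1 := @dim_hw2 1 0 (-1) 1 erefl.
have h2 := @dim_hw2 1 1 (-2) 0 erefl.
have ker0 := limg_ker_dim d0 M0; have ker1 := limg_ker_dim d1 M1.
rewrite -inv_ker in ker0.
have two0 : (2 : K) != 0 by rewrite pnatr_eq0.
have zeroC x y z v : v \in hw2 (wt x y z) -> z < x -> casimir predT v = 0 -> v = 0.
  by move=> /hw2P[av _]; apply: casimir_inj av.
have eq1 : \dim (M1 :&: lker d1)%VS = \dim (d0 @: M0).
  apply/eqP; rewrite eqn_leq; apply/andP; split.
    rewrite -(@limg_dim_eq _ _ _ (d0 \o p1)%VF).
      rewrite limg_comp; apply/dimvS/limgS/(subv_trans _ p1_sub)/limgS.
      exact: capvSl.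
    apply/eqP; rewrite -subv0; apply/subvP => v.
    rewrite memv0 => /memv_capP[/memv_capP[v1]]; rewrite !memv_ker comp_lfunE.
    move=> /eqP dv /eqP pv.
    apply/eqP; apply: (zeroC 1 0 (-1) v v1) => //.
    by rewrite (homotopy1 v1) dv pv linear0 addr0 scaler0.
  apply: dimvS; rewrite subv_cap d0_sub /=; apply/subvP => _ /memv_imgP[v /hw2P[av v01] ->].
  rewrite memv_ker d1E (eC o1 o0 o0 o2) /=.
  rewrite (@sl2_weight0 _ v o0 o1 isT av) // (eC o1 o2 o0 o2) linear0 /=.
  by rewrite !scale0r !scale1r addr0 !subr0 add0r subrr.
have eq2 : \dim (d1 @: M1) = \dim M2.
  apply/eqP; rewrite eqn_leq (dimvS d1_sub) /=.
  rewrite -(@limg_dim_eq _ _ _ (d1 \o p2)%VF M2).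
    by rewrite limg_comp; apply/dimvS/limgS/p2_sub.
  apply/eqP; rewrite -subv0; apply/subvP => v.
  rewrite memv0 => /memv_capP[v2]; rewrite memv_ker comp_lfunE => /eqP pv.
  by apply/eqP; apply: (zeroC 1 1 (-2) v v2) => //; rewrite (homotopy2 v2) pv scaler0.
rewrite -!/(weight_dim _ _ _) -!/M0 -!/M1 -!/M2 in h0 h1 h2 *.
rewrite (_ : (0 + 1 : int) = 1) // (_ : (0 - 1 : int) = -1) // in h0.
rewrite (_ : (1 + 1 : int) = 2) // (_ : (0 - 1 : int) = -1) // in h1.
rewrite (_ : (1 + 1 : int) = 2) // (_ : (1 - 1 : int) = 0) // in h2.
lia.
Qed.
End GL3.

(** * Substitution and derivations of polynomials *)

Section Generic.
Variables (K : numFieldType) (n : nat).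
Implicit Types p q : {mpoly K[n]}.

Lemma mpoly_gen_ind (P : {mpoly K[n]} -> Prop) :
    (forall c, P c%:MP) -> (forall i, P 'X_i) ->
    (forall p q, P p -> P q -> P (p + q)) -> (forall p q, P p -> P q -> P (p * q)) ->
  forall p, P p.
Proof.
move=> PC PX PD PM p; rewrite [p]mpolyE; elim/big_ind: _ => [||m _].
- by rewrite -mpolyC0; apply: PC.
- exact: PD.
rewrite -mul_mpolyC; apply: (PM) => //; rewrite mpolyXE_id.
elim/big_ind: _ => [||i _]; first by rewrite -mpolyC1; apply: PC.
- exact: PM.
by elim: (m i) => [|k IHk]; [rewrite expr0 -mpolyC1 | rewrite exprS; apply: PM].
Qed.

(** Substitution of univariate polynomials for the variables: a curve in the affine space. *)
Definition msubst (c : 'I_n -> {poly K}) p : {poly K} := mmap (@polyC K) c p.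

Lemma msubstD c : {morph msubst c : p q / p + q}. Proof. exact: mmapD. Qed.
Lemma msubstM c : {morph msubst c : p q / p * q}.
Proof. by move=> p q; rewrite /msubst rmorphM. Qed.
Lemma msubstX c i : msubst c 'X_i = c i.
Proof. by rewrite /msubst mmapX mmap1U. Qed.
Lemma msubstC c a : msubst c a%:MP = a%:P.
Proof. exact: mmapC. Qed.
Lemma msubst_sum c (I : Type) (r : seq I) (P : pred I) F :
  msubst c (\sum_(i <- r | P i) F i) = \sum_(i <- r | P i) msubst c (F i).
Proof. exact: raddf_sum. Qed.

Lemma horner_msubst c p t : (msubst c p).[t] = p.@[fun k => (c k).[t]].
Proof.
elim/mpoly_gen_ind: p => [a|i|p q IHp IHq|p q IHp IHq].
- by rewrite msubstC hornerC mevalC.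
- by rewrite msubstX mevalXU.
- by rewrite msubstD hornerD IHp IHq mevalD.
by rewrite msubstM hornerM IHp IHq mevalM.
Qed.

(** The chain rule. *)
Lemma deriv_msubst c p :
  (msubst c p)^`() = \sum_k (c k)^`() * msubst c p^`M(k).
Proof.
elim/mpoly_gen_ind: p => [a|i|p q IHp IHq|p q IHp IHq].
- rewrite msubstC derivC big1 // => k _.
  by rewrite mderivC -mpolyC0 msubstC mulr0.
- rewrite msubstX (bigD1 i) //= big1 => [|k ki].
    have -> : ('X_i : {mpoly K[n]})^`M(i) = 1%:MP.
      rewrite mderivX mnm1E eqxx scale1r mpolyC1 -mpolyX0; congr ('X_[_]).
      by apply/mnmP => j; rewrite mnmBE subnn mnm0E.
    by rewrite msubstC mulr1 addr0.
  by rewrite mderivX mnm1E eq_sym (negPf ki) scale0r -mpolyC0 msubstC mulr0.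
- rewrite msubstD derivD IHp IHq -big_split /=; apply: eq_bigr => k _.
  by rewrite mderivD msubstD mulrDr.
rewrite msubstM derivM IHp IHq mulr_suml mulr_sumr -big_split /=; apply: eq_bigr => k _.
by rewrite mderivM msubstD !msubstM; ring.
Qed.

Lemma poly_const (P : {poly K}) a : (forall t, P.[t] = a) -> P = a%:P.
Proof.
move=> Pa; apply/eqP; rewrite -subr_eq0; set Q := P - _; apply/negPn/negP => Q0.
pose rs := [seq k%:R : K | k <- iota 0 (size Q)].
have rQ : all (root Q) rs.
  by apply/allP => t _; rewrite rootE /Q hornerD hornerN hornerC Pa subrr.
have urs : uniq rs.
  by rewrite map_inj_uniq ?iota_uniq // => x y /eqP; rewrite eqr_nat => /eqP.
by have := max_poly_roots Q0 rQ urs; rewrite size_map size_iota ltnn.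
Qed.

Lemma deriv_eq0 (P : {poly K}) : P^`() = 0 -> P = (P.[0])%:P.
Proof.
move=> P0; apply/polyP => [[|k]]; rewrite coefC /= ?horner_coef0 //.
have /eqP : P^`()`_k = 0 by rewrite P0 coef0.
by rewrite coef_deriv -mulr_natr mulf_eq0 pnatr_eq0 orbF => /eqP.
Qed.

Lemma meval_at0 p : p.@[fun=> 0] = p@_0.
Proof.
rewrite mevalE [p in RHS]mpolyE raddf_sum /=; apply: eq_bigr => m _.
rewrite mcoeffZ mcoeffX; congr (_ * _).
case: eqP => [->|m0]; first by rewrite big1 // => i _; rewrite mnm0E.
have [i mi] : exists i, m i != 0%N.
  apply/existsP; rewrite -negb_forall; apply/negP => /forallP H; apply: m0.
  by apply/mnmP => i; rewrite mnm0E; apply/eqP.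
by rewrite (bigD1 i) //= expr0n (negPf mi) mul0r.
Qed.

(** Partial derivatives of a function that vanishes everywhere vanish everywhere, as one sees on
    lines. The coefficient of a monomial is, up to a product of factorials, the value at 0 of an
    iterated derivative. *)
Lemma mpoly_eq0_meval p : (forall v, p.@[v] = 0) -> p = 0.
Proof.
have step k q : (forall v, q.@[v] = 0) -> forall v, q^`M(k).@[v] = 0.
  move=> q0 v; pose c i : {poly K} := (v i)%:P + (i == k)%:R *: 'X.
  have : msubst c q = 0%:P.
    by apply: poly_const => t; rewrite horner_msubst.
  move/(congr1 (fun P => P^`().[0])); rewrite deriv_msubst derivC horner0 horner_sum.
  rewrite (bigD1 k) //= big1 ?addr0 => [|i /negPf ik].
    rewrite hornerM horner_msubst /c eqxx scale1r derivD derivC derivX add0r hornerC mul1r.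
    move=> <-; apply: meval_eq => i; rewrite -/(c i).
    by rewrite !hornerE ?mulr0 ?addr0.
  by rewrite /c ik scale0r addr0 derivC mul0r horner0.
move=> p0; apply/mpolyP => m; rewrite mcoeff0.
have : (p^`M[m]).@[fun=> 0] = 0.
  rewrite mderivm_foldr; move: (fun=> 0); elim: (flatten _) => [|k s IHs] //=.
  exact: step.
rewrite meval_at0 mcoeff_mderivm addm0 => /eqP; rewrite -mulr_natr mulf_eq0 pnatr_eq0.
rewrite -leqn0 leqNgt prodn_gt0 ?orbF => [/eqP // | i].
by rewrite ffactnn fact_gt0.
Qed.

(** The derivation with the values [L] on the variables. *)
Definition der (L : 'I_n -> {mpoly K[n]}) p := \sum_k L k * p^`M(k).

Lemma der_is_linear L : linear (der L).
Proof.
move=> a p q; rewrite /der scaler_sumr -big_split /=; apply: eq_bigr => k _.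
by rewrite mderivD mderivZ mulrDr scalerAr.
Qed.
HB.instance Definition _ L := GRing.isLinear.Build K {mpoly K[n]} {mpoly K[n]} _
  (der L) (der_is_linear L).

Lemma derM L p q : der L (p * q) = der L p * q + p * der L q.
Proof.
rewrite /der mulr_suml mulr_sumr -big_split /=; apply: eq_bigr => k _.
by rewrite mderivM; ring.
Qed.

Lemma derX L i : der L 'X_i = L i.
Proof.
rewrite /der (bigD1 i) //= big1 => [|k ki].
  have -> : ('X_i : {mpoly K[n]})^`M(i) = 1%:MP.
    rewrite mderivX mnm1E eqxx scale1r mpolyC1 -mpolyX0; congr ('X_[_]).
    by apply/mnmP => j; rewrite mnmBE subnn mnm0E.
  by rewrite mpolyC1 mulr1 addr0.
by rewrite mderivX mnm1E eq_sym (negPf ki) scale0r mulr0.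
Qed.

Lemma eq_der L M p : L =1 M -> der L p = der M p.
Proof. by move=> LM; apply: eq_bigr => k _; rewrite LM. Qed.

Lemma derB a b L M p :
  a *: der L p - b *: der M p = der (fun k => a *: L k - b *: M k) p.
Proof.
rewrite /der !scaler_sumr -sumrB; apply: eq_bigr => k _.
by rewrite !scalerAl mulrBl.
Qed.

(** The terms with second derivatives cancel. *)
Lemma der_comm L M p : der L (der M p) - der M (der L p) =
  der (fun k => der L (M k) - der M (L k)) p.
Proof.
have E A B : der A (der B p) =
    \sum_k der A (B k) * p^`M(k) + \sum_k \sum_l A l * B k * p^`M(k)^`M(l).
  rewrite [in LHS](_ : der B p = \sum_k B k * p^`M(k)) // linear_sum -big_split /=; apply: eq_bigr => k _.
  rewrite derM; congr (_ + _).
  by rewrite /der mulr_sumr; apply: eq_bigr => l _; ring.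
have -> : der L (der M p) - der M (der L p) =
    \sum_k der L (M k) * p^`M(k) - \sum_k der M (L k) * p^`M(k).
  rewrite !E opprD addrACA -[RHS]addr0; congr (_ + _); apply/eqP; rewrite subr_eq0.
  apply/eqP; rewrite exchange_big; apply: eq_bigr => k _; apply: eq_bigr => l _ /=.
  by rewrite mderiv_comm; ring.
by rewrite -sumrB; apply: eq_bigr => k _; rewrite mulrBl.
Qed.
End Generic.

(** * Generation of SL(n) by transvections *)

Section Transvections.
Variable F : fieldType.

Definition transvection n (i j : 'I_n) (t : F) : 'M[F]_n := 1%:M + t *: delta_mx i j.

Lemma transvectionN n (i j : 'I_n) t : i != j ->
  transvection i j (- t) *m transvection i j t = 1%:M.
Proof.
move=> ij; rewrite /transvection mulmxDl mul1mx mulmxDr mulmx1 -scalemxAl -scalemxAr.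
by rewrite mul_delta_mx_0 1?eq_sym // !scaler0 addr0 -addrA -scalerDl subrr scale0r addr0.
Qed.

Lemma det_transvection n (i j : 'I_n) t : i != j -> \det (transvection i j t) = 1.
Proof.
have low (k l : 'I_n) : (l < k)%N -> \det (transvection k l t) = 1.
  move=> lk; rewrite det_trig ?big1 // => [m _|].
    rewrite !mxE eqxx; case: eqP => [->|_]; rewrite ?mulr0 ?addr0 //.
    by rewrite -val_eqE gtn_eqF // mulr0 addr0.
  apply/is_trig_mxP => a b ab; rewrite !mxE -!val_eqE ltn_eqF //= add0r.
  case: eqP => [ak|_]; rewrite ?mulr0 //= gtn_eqF ?mulr0 //.
  by rewrite (ltn_trans lk) // -ak.
move=> ij; have [ltij|ltji|/val_inj eij] := ltngtP i j.
- rewrite -det_tr (_ : _^T = transvection j i t) ?low //.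
  by rewrite /transvection linearD linearZ /= trmx1 trmx_delta.
- exact: low.
by rewrite eij eqxx in ij.
Qed.

Lemma transvection_mulE n (i j : 'I_n) t (A : 'M[F]_n) k l :
  (transvection i j t *m A) k l = A k l + (k == i)%:R * t * A j l.
Proof.
rewrite /transvection mulmxDl mul1mx mxE; congr (_ + _).
rewrite -scalemxAl mxE mxE (bigD1 j) //= !mxE eqxx andbT big1 ?addr0.
  by rewrite mulrCA mulrA.
by move=> m /negPf mj; rewrite mxE mj andbF mul0r.
Qed.

(** Gaussian elimination without scalings. If some entry of the first column below the corner is
    nonzero, a multiple of its row turns the corner entry into 1; then the first row and column
    are cleared, and a smaller matrix of determinant 1 remains. *)
Theorem SL_ind n (H : 'M[F]_n -> Prop) :
    H 1%:M -> (forall A B, H A -> H B -> H (A *m B)) ->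
    (forall i j t, i != j -> H (transvection i j t)) ->
  forall g, \det g = 1 -> H g.
Proof.
elim: n H => [|n IHn] H H1 HM HT g dg.
  by rewrite (_ : g = 1%:M) //; apply/matrixP => - [].
have red i j t A : i != j -> H (transvection i j t *m A) -> H A.
  move=> ij HA; rewrite -[A]mul1mx -(transvectionN t ij) -mulmxA.
  by apply: HM HA; apply: HT.
(* Once the corner entry is 1, its column and its row can be cleared. *)
have corner (A : 'M_(1 + n)) : \det A = 1 -> A ord0 ord0 = 1 -> H A.
  move=> dA A00; pose v := dlsubmx A; pose u := ursubmx A; pose D := drsubmx A.
  have A1 : ulsubmx A = 1%:M.
    by apply/matrixP => i j; rewrite !ord1 !mxE /= -[RHS]A00; congr (A _ _); apply: val_inj.
  have AE : A = block_mx 1%:M 0 v 1%:M *m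
      (block_mx 1%:M 0 0 (D - v *m u) *m block_mx 1%:M u 0 1%:M).
    rewrite !mulmx_block !(mul0mx, mulmx0, mul1mx, mulmx1, addr0, add0r).
    by rewrite addrCA subrr addr0 -[LHS]submxK A1.
  have dD : \det (D - v *m u) = 1.
    rewrite -dA AE !det_mulmx !det_ublock !det_lblock !det1.
    by rewrite !mul1r mulr1.
  rewrite AE; apply: (HM); [|apply: (HM)].
  - have : v = \sum_i v i ord0 *: delta_mx i ord0.
      by rewrite {1}[v]matrix_sum_delta; apply: eq_bigr => i _; rewrite big_ord1.
    move=> ->; elim/big_ind: _ => [|x y Hx Hy|i _].
    + by rewrite -scalar_mx_block.
    + rewrite (_ : block_mx _ _ _ _ = block_mx 1%:M 0 x 1%:M *m block_mx 1%:M 0 y 1%:M).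
        exact: HM.
      by rewrite mulmx_block !(mul0mx, mulmx0, mul1mx, mulmx1, addr0, add0r).
    + have := HT (rshift 1 i) (@lshift 1 n ord0) (v i ord0) isT.
      congr H; rewrite /transvection -[_.+1]/(1 + n)%N scalar_mx_block.
      rewrite (_ : delta_mx _ _ = block_mx 0 0 (delta_mx i ord0) 0).
        by rewrite scale_block_mx add_block_mx !scaler0 !addr0 add0r.
      by rewrite /block_mx delta_mx_dshift delta_mx_lshift row_mx0.
  - apply: (IHn (fun h : 'M_n => H (block_mx (1%:M : 'M_1) 0 0 h)) _ _ _ _ dD) => [|h k Hh Hk|i j t ij].
    + by rewrite -scalar_mx_block.
    + rewrite (_ : block_mx _ _ _ _ = block_mx (1%:M : 'M_1) 0 0 h *m block_mx 1%:M 0 0 k).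
        exact: HM Hh Hk.
      by rewrite mulmx_block !(mul0mx, mulmx0, mul1mx, addr0, add0r).
    + have ne : rshift 1 i != rshift 1 j by rewrite (inj_eq (@rshift_inj _ _)).
      have := HT (rshift 1 i) (rshift 1 j) t ne.
      congr H; rewrite /transvection -[_.+1]/(1 + n)%N scalar_mx_block.
      rewrite (_ : delta_mx _ _ = block_mx 0 0 0 (delta_mx i j)).
        by rewrite scale_block_mx add_block_mx !scaler0 !addr0.
      by rewrite /block_mx delta_mx_dshift delta_mx_rshift row_mx0.
  - have : u = \sum_i u ord0 i *: delta_mx ord0 i.
      by rewrite {1}[u]matrix_sum_delta big_ord1.
    move=> ->; elim/big_ind: _ => [|x y Hx Hy|i _].
    + by rewrite -scalar_mx_block.
    + rewrite (_ : block_mx _ _ _ _ = block_mx 1%:M y 0 1%:M *m block_mx 1%:M x 0 1%:M).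
        exact: HM.
      by rewrite mulmx_block !(mul0mx, mulmx0, mul1mx, mulmx1, addr0, add0r).
    + have := HT (@lshift 1 n ord0) (rshift 1 i) (u ord0 i) isT.
      congr H; rewrite /transvection -[_.+1]/(1 + n)%N scalar_mx_block.
      rewrite (_ : delta_mx _ _ = block_mx 0 (delta_mx ord0 i) 0 0).
        by rewrite scale_block_mx add_block_mx !scaler0 !addr0 add0r.
      by rewrite /block_mx delta_mx_ushift delta_mx_rshift row_mx0.
(* A nonzero entry below the corner makes it possible to produce 1 in the corner. *)
have below (A : 'M_(1 + n)) i : \det A = 1 -> i != ord0 -> A i ord0 != 0 -> H A.
  move=> dA i0 Ai; apply: (red ord0 i ((1 - A ord0 ord0) / A i ord0)).
    by rewrite eq_sym.
  apply: corner; first by rewrite det_mulmx det_transvection 1?eq_sym // mul1r.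
  by rewrite transvection_mulE eqxx mul1r divfK // addrC subrK.
have [i Ai] : exists i, g i ord0 != 0.
  apply/existsP; rewrite -negb_forall; apply/negP => /forallP g0.
  move: dg; rewrite (expand_det_col _ ord0) big1 => [/esym/eqP|i _].
    by rewrite oner_eq0.
  by rewrite (eqP (g0 i)) mul0r.
have [i0|i0] := eqVneq i ord0; last exact: below Ai.
subst i.
case: n IHn H H1 HM HT g dg red corner below Ai => [|n] IHn H H1 HM HT g dg red corner below Ai.
  apply: corner => //; move: dg; rewrite (expand_det_col _ ord0) big_ord1.
  by rewrite /cofactor det_mx00 expr0 !mulr1.
have [g1|] := eqVneq (g (lift ord0 ord0) ord0) 0; last exact: below.
apply: (red (lift ord0 ord0) ord0 1 _ isT).
apply: (below _ (lift ord0 ord0)) => //.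
  by rewrite det_mulmx det_transvection // mul1r.
by rewrite transvection_mulE g1 eqxx add0r !mul1r.
Qed.
End Transvections.

(** * The action of gl(3) on polynomials in three symmetric matrices *)

(** The linear coordinate that gives the entry (r, s) of a symmetric matrix, in either order. *)
Definition entry_index (r s : 'I_3) : 'I_6 :=
  inord (index (if (r <= s)%N then (r, s) else (s, r)) sym_entry).

Lemma entry_indexC r s : entry_index r s = entry_index s r.
Proof. by rewrite /entry_index; case: ltngtP => // /val_inj ->. Qed.

Lemma tnth_entry_index (r s : 'I_3) : (r <= s)%N ->
  tnth sym_entry (entry_index r s) = (r, s).
Proof.
move=> rs; have [e e_rs] := sym_entryP rs.
have rsin : (r, s) \in (sym_entry : seq _) by rewrite -e_rs mem_tnth.
rewrite /entry_index rs (tnth_nth (r, s)) inordK ?nth_index //.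
by move: rsin; rewrite -index_mem size_tuple.
Qed.

Lemma entry_indexK e : entry_index (tnth sym_entry e).1 (tnth sym_entry e).2 = e.
Proof.
rewrite /entry_index sym_entry_le -surjective_pairing (tnth_nth (ord0, ord0)) index_uniq.
- exact: inord_val.
- by rewrite size_tuple.
- exact: sym_entry_uniq.
Qed.

(** Locked, as unfolding [mxvec_index] enumerates all index pairs. *)
HB.lock Definition var_index (c r s : 'I_3) : 'I_18 := mxvec_index c (entry_index r s).

Lemma var_indexC c r s : var_index c r s = var_index c s r.
Proof. by rewrite unlock entry_indexC. Qed.

Lemma var_indexP (k : 'I_18) : exists c r s, k = var_index c r s /\ (r <= s)%N.
Proof.
case/(@mxvec_indexP 3 6): k => c e; exists c, (tnth sym_entry e).1, (tnth sym_entry e).2.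
by rewrite unlock entry_indexK sym_entry_le.
Qed.

Lemma mxvec_var_index (c : 'I_3) (e : 'I_6) :
  mxvec_index c e = var_index c (tnth sym_entry e).1 (tnth sym_entry e).2.
Proof. by rewrite unlock entry_indexK. Qed.

Section Operators.
Variable K : numFieldType.
Local Notation MP := {mpoly K[18]}.

Definition symvar c r s : MP := 'X_(var_index c r s).

Lemma symvarC c r s : symvar c r s = symvar c s r.
Proof. by rewrite /symvar var_indexC. Qed.

Lemma coords_var (x : 'I_3 -> 'M[K]_3) c r s : (forall k, x k \is symmetricmx) ->
  coords x (var_index c r s) = x c r s.
Proof.
move=> sx; have sxc a b : x c a b = x c b a.
  by have /is_hermitianmxP H := sx c; rewrite {1}H expr0 scale1r !mxE.
have le (a b : 'I_3) : (a <= b)%N -> coords x (var_index c a b) = x c a b.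
  by move=> ab; rewrite unlock coordsE tnth_entry_index.
by case: (leqP r s) => [/le // | /ltnW/le]; rewrite var_indexC sxc.
Qed.

(** The matrix unit (i, j) acts on a symmetric matrix by replacing, in turn, each index j of an
    entry by i. This is the derivative of the action of the transvection (j, i). *)
Definition gl_gen (i j : 'I_3) (k : 'I_18) : MP :=
  (mxvec (\matrix_(c < 3, e < 6)
     (((tnth sym_entry e).1 == j)%:R * symvar c i (tnth sym_entry e).2
      + ((tnth sym_entry e).2 == j)%:R * symvar c (tnth sym_entry e).1 i)) : 'rV[MP]_18) 0 k.

Lemma gl_genE i j c r s :
  gl_gen i j (var_index c r s) = (r == j)%:R * symvar c i s + (s == j)%:R * symvar c r i.
Proof.
have le (a b : 'I_3) : (a <= b)%N ->
    gl_gen i j (var_index c a b) = (a == j)%:R * symvar c i b + (b == j)%:R * symvar c a i.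
  move=> ab; rewrite [var_index]unlock; apply: etrans (mxvecE _ _ _) _.
  by rewrite mxE tnth_entry_index.
case: (leqP r s) => [/le // | /ltnW/le]; rewrite var_indexC => ->.
by rewrite (symvarC c s i) (symvarC c i r) [LHS]addrC.
Qed.

Definition gl_der i j (p : MP) : MP := der (gl_gen i j) p.
HB.instance Definition _ i j := GRing.isLinear.Build K MP MP _ (gl_der i j)
  (@der_is_linear K 18 (gl_gen i j)).

Lemma gl_der_symvar i j c r s : gl_der i j (symvar c r s) = (r == j)%:R * symvar c i s + (s == j)%:R * symvar c r i.
Proof. by rewrite /gl_der derX gl_genE. Qed.

Lemma gl_der_nat i j (n : nat) p : gl_der i j (n%:R * p) = n%:R * gl_der i j p.
Proof. by rewrite !mulr_natl linearMn. Qed.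

Lemma scale_nat (n : nat) (p : MP) : n%:R *: p = n%:R * p.
Proof. by rewrite scaler_nat mulr_natl. Qed.

Lemma gl_der_comm i j k l p : gl_der i j (gl_der k l p) - gl_der k l (gl_der i j p) =
  (j == k)%:R *: gl_der i l p - (l == i)%:R *: gl_der k j p.
Proof.
rewrite der_comm derB; apply: eq_der => m.
have [c [r [s [-> _]]]] := var_indexP m => {m}.
have E a b u v : der (gl_gen a b) (gl_gen u v (var_index c r s)) =
    (r == v)%:R * ((u == b)%:R * symvar c a s + (s == b)%:R * symvar c u a)
    + (s == v)%:R * ((r == b)%:R * symvar c a u + (u == b)%:R * symvar c r a).
  by rewrite gl_genE -[der _ _]/(gl_der a b _) linearD /= !gl_der_nat !gl_der_symvar.
rewrite (E i j k l) (E k l i j) !gl_genE !scale_nat.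
by rewrite [k == j]eq_sym [i == l]eq_sym (symvarC c k i); ring.
Qed.
Lemma sum_var (V : nmodType) (F : 'I_18 -> V) :
  \sum_k F k = \sum_(c < 3) \sum_(e < 6) F (mxvec_index c e).
Proof.
rewrite (reindex _ (curry_mxvec_bij 3 6)) pair_bigA.
by apply: eq_bigr => - [c e] _.
Qed.

(** The number of indices i in the entry [e]. *)
Definition ewt (i : 'I_3) (e : 'I_6) : nat :=
  ((tnth sym_entry e).1 == i) + ((tnth sym_entry e).2 == i).

Definition mwt (i : 'I_3) (m : 'X_{1..18}) : nat :=
  \sum_(c < 3) \sum_(e < 6) ewt i e * m (mxvec_index c e).

Lemma gl_gen_diag i (c : 'I_3) (e : 'I_6) :
  gl_gen i i (mxvec_index c e) = (ewt i e)%:R *: 'X_(mxvec_index c e) :> MP.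
Proof.
rewrite mxvec_var_index gl_genE /ewt natrD scalerDl !scale_nat -/(symvar _ _ _).
by congr (_ + _); case: eqP => [->|]; rewrite ?mul0r.
Qed.

Lemma mulX_mderivX (k : 'I_18) m :
  'X_k * ('X_[m])^`M(k) = (m k)%:R *: 'X_[m] :> MP.
Proof.
rewrite mderivX -scalerAr; have [->|mk] := eqVneq (m k) 0%N; first by rewrite !scale0r.
congr (_ *: _); rewrite -mpolyXD addmC submK //; apply/forallP => l.
by rewrite mnm1E; case: eqP => [<-|//]; rewrite lt0n.
Qed.

Lemma gl_der_diagX i m : gl_der i i 'X_[m] = (mwt i m)%:R *: 'X_[m].
Proof.
rewrite /gl_der /der sum_var /mwt natr_sum scaler_suml; apply: eq_bigr => c _.
rewrite natr_sum scaler_suml; apply: eq_bigr => e _.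
by rewrite gl_gen_diag -scalerAl mulX_mderivX scalerA natrM.
Qed.

Lemma mcoeff_gl_der_diag i p m : (gl_der i i p)@_m = (mwt i m)%:R * p@_m.
Proof.
rewrite [p in LHS]mpolyE [gl_der _ _ _]linear_sum raddf_sum /=.
under eq_bigr => m' _ do rewrite linearZ /= gl_der_diagX !mcoeffZ.
rewrite [p in RHS]mpolyE (raddf_sum (mcoeff m)) mulr_sumr; apply: eq_bigr => m' _ /=.
by rewrite mcoeffZ mcoeffX; case: eqP => [->|_]; rewrite ?mulr0 // !mulr1 mulrC.
Qed.

(** Every entry carries two indices. *)
Lemma mwt_sum m : (mwt o0 m + mwt o1 m + mwt o2 m = 2 * mdeg m)%N.
Proof.
rewrite mdegE sum_var /mwt -!big_split big_distrr; apply: eq_bigr => c _ /=.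
rewrite -!big_split big_distrr; apply: eq_bigr => e _ /=.
rewrite -!mulnDl; congr (_ * _)%N; rewrite /ewt.
have one (r : 'I_3) : ((r == o0) + (r == o1) + (r == o2) = 1)%N.
  by case: r => [[|[|[|//]]] lt].
have := one (tnth sym_entry e).1; have := one (tnth sym_entry e).2.
set a0 := (_ == o0); set a1 := (_ == o1); set a2 := (_ == o2).
set b0 := (_ == o0); set b1 := (_ == o1); set b2 := (_ == o2).
by case: a0; case: a1; case: a2 => //; case: b0; case: b1; case: b2.
Qed.

Lemma homog_gl_der n i j p : p \is n.-homog -> gl_der i j p \is n.-homog.
Proof.
move=> hp; rewrite [p]mpolyE [gl_der _ _ _]linear_sum big_seq.
apply: rpred_sum => m mp; rewrite linearZ /=; apply: rpredZ.
have hm := dhomog_mf hp mp.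
rewrite /gl_der /der; apply: rpred_sum => k _; rewrite mderivX -scalerAr.
have [->|mk] := eqVneq (m k) 0%N; first by rewrite scale0r rpred0.
have : mdeg (U_(k) + (m - U_(k))) = n.
  rewrite addmC submK ?hm //; apply/forallP => l.
  by rewrite mnm1E; case: eqP => [<-|//]; rewrite lt0n.
rewrite mdegD mdeg1 => <-.
apply: rpredZ; apply: dhomogM; last by rewrite dhomogX.
have [c [r [s [-> _]]]] := var_indexP k; rewrite gl_genE !mulr_natl.
by rewrite rpredD // rpredMn // dhomogX /= mdeg1.
Qed.

Section Degree.
Variable n : nat.
Local Notation W := (dhomog 18 K n).

Lemma dhomog_inj (u v : W) : mpoly_of_dhomog u = mpoly_of_dhomog v -> u = v.
Proof. exact: val_inj. Qed.

Lemma dhomogB_val (u v : W) : mpoly_of_dhomog (u - v) = (u : MP) - (v : MP).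
Proof. exact: linearB. Qed.
Lemma dhomogD_val (u v : W) : mpoly_of_dhomog (u + v) = (u : MP) + (v : MP).
Proof. exact: linearD. Qed.
Lemma dhomogZ_val a (u : W) : mpoly_of_dhomog (a *: u) = a *: (u : MP).
Proof. exact: linearZ. Qed.
Lemma dhomog0_val : mpoly_of_dhomog (0 : W) = 0.
Proof. exact: linear0. Qed.
Lemma gl_derBZ i j p a q : gl_der i j (p - a *: q) = gl_der i j p - a *: gl_der i j q.
Proof. by rewrite linearB linearZ. Qed.

Definition gl_hom i j (p : W) : W := DHomog (homog_gl_der i j (dhomog_is_dhomog p)).

Lemma gl_hom_is_linear i j : linear (gl_hom i j).
Proof. by move=> a p q; apply: val_inj; rewrite /= !linearP. Qed.
HB.instance Definition _ i j := GRing.isLinear.Build K W W _ (gl_hom i j)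
  (gl_hom_is_linear i j).

Definition mean_weight : K := (2 * n)%N%:R / 3%:R.

(** The diagonal units are shifted by the average of the three weights of a monomial of degree n,
    so that the weight of an SL(3)-invariant becomes 0. *)
Definition gl_end (i j : 'I_3) : 'End(W) :=
  linfun (gl_hom i j) - ((i == j)%:R * mean_weight) *: \1%VF.

Lemma gl_endE i j p :
  mpoly_of_dhomog (gl_end i j p) = gl_der i j p - ((i == j)%:R * mean_weight) *: (p : MP).
Proof. by rewrite /gl_end add_lfunE opp_lfunE scale_lfunE id_lfunE lfunE linearB linearZ. Qed.

Local Opaque gl_end.

Lemma gl_end_comm i j k l v : gl_end i j (gl_end k l v) =
  gl_end k l (gl_end i j v) + (j == k)%:R *: gl_end i l v - (l == i)%:R *: gl_end k j v.
Proof.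
apply: dhomog_inj; rewrite dhomogB_val dhomogD_val 2!dhomogZ_val.
rewrite (gl_endE i j) (gl_endE k l (gl_end i j v)) (gl_endE k l v) (gl_endE i j v).
rewrite gl_endE gl_endE; set q := mpoly_of_dhomog v.
rewrite !gl_derBZ; move/eqP: (gl_der_comm i j k l q); rewrite subr_eq addrC => /eqP ->.
have dd : (j == k)%:R * ((i == l)%:R * mean_weight) = (l == i)%:R * ((k == j)%:R * mean_weight) :> K.
  by rewrite [k == j]eq_sym [l == i]eq_sym; ring.
set x := gl_der k l _; set y := gl_der i j _; set z := gl_der i l _; set w := gl_der k j _.
rewrite !scalerBr !scalerA dd -!mul_mpolyC.
rewrite [(i == j)%:R * _ * _]mulrC.
ring.
Qed.

Lemma gl_end_trace v : gl_end o0 o0 v + gl_end o1 o1 v + gl_end o2 o2 v = 0.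
Proof.
apply: dhomog_inj; rewrite !dhomogD_val dhomog0_val !gl_endE; apply/mpolyP => m.
rewrite !mcoeffD !mcoeffN !mcoeffZ !mcoeff_gl_der_diag eqxx mul1r.
have [->|vm] := eqVneq (v : MP)@_m 0; first by rewrite !mulr0 mcoeff0; ring.
have hm : mdeg m = n by apply: (dhomog_mf (dhomog_is_dhomog v)); rewrite mcoeff_msupp.
have E : (mwt o0 m)%:R + (mwt o1 m)%:R + (mwt o2 m)%:R = (2 * n)%N%:R :> K.
  by rewrite -!natrD mwt_sum hm.
by rewrite mcoeff0 /mean_weight -E; field.
Qed.

Lemma gl_end_weight i a (v : W) : gl_end i i v = a *: v <->
  (forall m, m \in msupp v -> (mwt i m)%:R = a + mean_weight).
Proof.
have C m : (gl_end i i v : MP)@_m = ((mwt i m)%:R - mean_weight) * (v : MP)@_m.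
  by rewrite gl_endE mcoeffB mcoeffZ mcoeff_gl_der_diag eqxx mul1r mulrBl.
split=> [H m mv | H].
  have := C m; rewrite H dhomogZ_val mcoeffZ => /esym/mulIf E.
  by rewrite -E ?subrK // -mcoeff_msupp.
apply/dhomog_inj/mpolyP => m; rewrite C dhomogZ_val mcoeffZ.
have [->|vm] := eqVneq (v : MP)@_m 0; first by rewrite !mulr0.
by rewrite H ?addrK // mcoeff_msupp.
Qed.

Lemma gl_end_bounded : exists m0 : K, exists N : nat, forall i (a : K) v,
  v != 0 -> gl_end i i v = a *: v -> exists2 k : nat, (k <= N)%N & a + m0 = k%:R.
Proof.
exists mean_weight, (2 * n)%N => i a v v0 /gl_end_weight H.
have v0' : (v : MP) != 0 by apply: contra_neq v0 => v0; apply: val_inj.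
exists (mwt i (mlead v)); last by rewrite (H _ (mlead_supp v0')).
have hm : mdeg (mlead v) = n.
  by apply: (dhomog_mf (dhomog_is_dhomog v)); apply: mlead_supp.
have := mwt_sum (mlead v); rewrite hm => <-.
case: i {H} => [[|[|[|//]]] lt].
- by rewrite (_ : Ordinal lt = o0) ?[in leqLHS]/o0; [lia | apply: val_inj].
- by rewrite (_ : Ordinal lt = o1); [lia | apply: val_inj].
by rewrite (_ : Ordinal lt = o2); [lia | apply: val_inj].
Qed.
End Degree.
End Operators.

(** * Invariance under the group and under its Lie algebra *)

Section Invariance.
Variable K : numFieldType.
Local Notation MP := {mpoly K[18]}.

Lemma sym_act_transvection (i j : 'I_3) t (x : 'M[K]_3) r s :
  sym_act (transvection j i t) x r s =
  x r s + t * ((r == j)%:R * x i s + (s == j)%:R * x r i)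
  + t ^+ 2 * ((r == j)%:R * (s == j)%:R * x i i).
Proof.
have E (A : 'M[K]_3) :
    (A *m (transvection j i t)^T) r s = A r s + (s == j)%:R * t * A r i.
  by rewrite -[_ *m _]trmxK trmx_mul trmxK mxE transvection_mulE !mxE.
by rewrite /sym_act E !transvection_mulE; ring.
Qed.

Lemma sym_act_sym (g x : 'M[K]_3) : x \is symmetricmx -> sym_act g x \is symmetricmx.
Proof.
move=> /is_hermitianmxP; rewrite expr0 scale1r map_mx_id // => sx.
apply/is_hermitianmxP; rewrite expr0 scale1r map_mx_id // /sym_act.
by rewrite !trmx_mul trmxK -sx mulmxA.
Qed.

Lemma transvection0 n (i j : 'I_n) : transvection i j 0 = 1%:M :> 'M[K]_n.
Proof. by rewrite /transvection scale0r addr0. Qed.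

Lemma sym_act1 (x : 'M[K]_3) : sym_act 1%:M x = x.
Proof. by rewrite /sym_act mul1mx trmx1 mulmx1. Qed.

Lemma eq_coords (x y : 'I_3 -> 'M[K]_3) : x =1 y -> coords x =1 coords y.
Proof.
move=> xy k; rewrite /coords; congr (fun_of_matrix (mxvec _) _ _).
by apply/matrixP => c e; rewrite !mxE xy.
Qed.

Section OneParameter.
Variables (i j : 'I_3) (ij : i != j) (x : 'I_3 -> 'M[K]_3).
Hypothesis sx : forall k, x k \is symmetricmx.

Let xC c r s : x c r s = x c s r.
Proof.
by have /is_hermitianmxP H := sx c; rewrite {1}H expr0 scale1r !mxE.
Qed.

(** The entries of the transforms of x under the one-parameter group of the transvections (j, i),
    as polynomials in the parameter. *)
Definition orbit_entry c r s : {poly K} :=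
  (x c r s)%:P + 'X * ((r == j)%:R * (x c i s)%:P + (s == j)%:R * (x c r i)%:P)
  + 'X ^+ 2 * ((r == j)%:R * (s == j)%:R * (x c i i)%:P).

Let orbit_entryC c r s : orbit_entry c r s = orbit_entry c s r.
Proof. by rewrite /orbit_entry xC (xC c i s) (xC c r i); ring. Qed.

Let deriv_orbit c r s : (orbit_entry c r s)^`() =
  (r == j)%:R * orbit_entry c i s + (s == j)%:R * orbit_entry c r i.
Proof.
rewrite /orbit_entry (negPf ij) -!polyC_natr expr2 !(derivD, derivM, derivC, derivX).
by case: (r == j); case: (s == j) => /=; ring.
Qed.

Definition orbit_curve (k : 'I_18) : {poly K} :=
  (mxvec (\matrix_(c < 3, e < 6)
     orbit_entry c (tnth sym_entry e).1 (tnth sym_entry e).2) : 'rV[{poly K}]_18) 0 k.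

Let orbit_curveE c r s : orbit_curve (var_index c r s) = orbit_entry c r s.
Proof.
have le (a b : 'I_3) : (a <= b)%N -> orbit_curve (var_index c a b) = orbit_entry c a b.
  move=> ab; rewrite [var_index]unlock; apply: etrans (mxvecE _ _ _) _.
  by rewrite mxE tnth_entry_index.
by case: (leqP r s) => [/le // | /ltnW/le]; rewrite var_indexC orbit_entryC.
Qed.

Lemma horner_orbit t k :
  (orbit_curve k).[t] = coords (fun c => sym_act (transvection j i t) (x c)) k.
Proof.
have [c [r [s [-> _]]]] := var_indexP k.
rewrite orbit_curveE coords_var => [|l]; last exact: sym_act_sym.
rewrite sym_act_transvection /orbit_entry !hornerE -!polyC_natr !hornerE.
ring.
Qed.

(** Along the one-parameter group a polynomial changes at the rate given by the derivation. *)
Lemma deriv_orbit_subst (p : MP) :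
  (msubst orbit_curve p)^`() = msubst orbit_curve (gl_der i j p).
Proof.
rewrite deriv_msubst /gl_der /der msubst_sum; apply: eq_bigr => k _.
rewrite msubstM; congr (_ * _); have [c [r [s [-> _]]]] := var_indexP k.
rewrite orbit_curveE deriv_orbit gl_genE msubstD !msubstM -!polyC_natr -!mpolyC_nat.
by rewrite !msubstC /symvar !msubstX !orbit_curveE.
Qed.
End OneParameter.

(** A polynomial is constant along all one-parameter groups of transvections if and only if all
    its derivatives along them vanish. *)
Lemma SL3_invariant_gl_der (p : MP) :
  SL3_invariant p <-> (forall i j, j != i -> gl_der i j p = 0).
Proof.
split=> [Ip i j ji | gp].
  apply: mpoly_eq0_meval => v; have [x sx xv] := coords_surj v.
  have ij : i != j by rewrite eq_sym.
  have C : msubst (orbit_curve i j x) p = (p.@[coords x])%:P.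
    apply: poly_const => t; rewrite horner_msubst -(Ip (transvection j i t) x) //.
      by apply: meval_eq => k; rewrite horner_orbit.
    exact: det_transvection.
  have := deriv_orbit_subst ij sx p; rewrite C derivC => /(congr1 (fun P => P.[0])).
  rewrite horner0 horner_msubst => E; rewrite E; apply: meval_eq => k.
  by rewrite horner_orbit // -xv; apply: eq_coords => c; rewrite transvection0 sym_act1.
move=> g x dg; move: g dg x; apply: SL_ind.
- by move=> x sx; apply/meval_eq/eq_coords => c; rewrite sym_act1.
- move=> A B HA HB x sx; rewrite -(HB x sx) -(HA (fun k => sym_act B (x k))).
    by apply/meval_eq/eq_coords => c; rewrite /sym_act trmx_mul !mulmxA.
  by move=> k; apply: sym_act_sym.
move=> j i t ji x sx; have ij : i != j by rewrite eq_sym.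
have := deriv_orbit_subst ij sx p; rewrite gp // [msubst _ 0]raddf0 => /deriv_eq0 C.
have at_t u : (msubst (orbit_curve i j x) p).[u] =
    p.@[coords (fun c => sym_act (transvection j i u) (x c))].
  by rewrite horner_msubst; apply: meval_eq => k; rewrite horner_orbit.
rewrite -at_t C hornerC at_t; apply/meval_eq/eq_coords => c.
by rewrite transvection0 sym_act1.
Qed.
End Invariance.

(** * Sequences given by polynomials *)

Definition pol_seq (s : nat) (f : nat -> rat) :=
  exists2 p : {poly rat}, (size p <= s)%N & forall n, f n = p.[n%:R].

Lemma eq_pol_seq s f g : f =1 g -> pol_seq s f -> pol_seq s g.
Proof. by move=> fg [p ps fp]; exists p => // n; rewrite -fg. Qed.

Lemma pol_seqW s t f : (s <= t)%N -> pol_seq s f -> pol_seq t f.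
Proof. by move=> st [p ps fp]; exists p => //; apply: leq_trans st. Qed.

Lemma pol_seq0 s : pol_seq s (fun=> 0).
Proof. by exists 0 => [|n]; rewrite ?size_poly0 ?horner0. Qed.

Lemma pol_seqD s f g : pol_seq s f -> pol_seq s g -> pol_seq s (fun n => f n + g n).
Proof.
move=> [p ps fp] [q qs gq]; exists (p + q) => [|n]; last by rewrite hornerD fp gq.
by rewrite (leq_trans (size_polyD _ _)) // geq_max ps.
Qed.

Lemma pol_seqZ s c f : pol_seq s f -> pol_seq s (fun n => c * f n).
Proof.
move=> [p ps fp]; exists (c *: p) => [|n]; last by rewrite hornerZ fp.
exact: leq_trans (size_scale_leq _ _) ps.
Qed.

Lemma pol_seqB s f g : pol_seq s f -> pol_seq s g -> pol_seq s (fun n => f n - g n).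
Proof.
move=> fs /(pol_seqZ (-1)) gs; apply: eq_pol_seq (pol_seqD fs gs) => n.
by rewrite mulN1r.
Qed.

Lemma pol_seqX s f : pol_seq s f -> pol_seq s.+1 (fun n => n%:R * f n).
Proof.
move=> [p ps fp]; exists ('X * p) => [|n]; last by rewrite hornerM hornerX fp.
by rewrite (leq_trans (size_polyMleq _ _)) // size_polyX.
Qed.

Lemma pol_seq_affine s f a b : pol_seq s f -> pol_seq s (fun n => f (a * n + b)%N).
Proof.
move=> [p ps fp]; exists (p \Po (a%:R *: 'X + b%:R%:P)) => [|n].
  have [->|p0] := eqVneq p 0; first by rewrite comp_poly0 size_poly0.
  apply: leq_trans ps; apply: leq_trans (size_comp_poly_leq _ _) _.
  set q := _ + _; have sq : (size q <= 2)%N.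
    rewrite (leq_trans (size_polyD _ _)) // geq_max (leq_trans (size_scale_leq _ _)) ?size_polyX //.
    exact: leq_trans (size_polyC_leq1 _) _.
  have : (0 < size p)%N by rewrite lt0n size_poly_eq0.
  by move: sq; case: (size q) => [|[|[|//]]] _ /=; lia.
by rewrite horner_comp !hornerE fp natrD natrM.
Qed.

(** The difference sequence of a multiple of the monomial of degree [size p] has the same leading
    term as [p]; subtract it and proceed by induction on the degree. *)
Lemma pol_seq_sum s f : pol_seq s f -> pol_seq s.+1 (fun n => \sum_(i < n.+1) f i).
Proof.
suff H (p : {poly rat}) : exists2 P : {poly rat}, (size P <= (size p).+1)%N &
    forall n, \sum_(i < n) p.[i%:R] = P.[n%:R].
  move=> [p ps fp]; have [P Ps PE] := H p.
  exists (P \Po ('X + 1%:P)) => [|n].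
    by rewrite size_comp_poly2 ?size_XaddC // (leq_trans Ps).
  rewrite horner_comp !hornerE natr1 -PE.
  by apply: eq_bigr => i _.
have [d] := ubnP (size p); elim: d p => // d IHd p pd.
have [->|p0] := eqVneq p 0.
  by exists 0 => [|n]; rewrite ?size_poly0 // horner0 big1 // => i _; rewrite horner0.
pose m := (size p).-1; have sp : size p = m.+1 by rewrite prednK // lt0n size_poly_eq0.
pose P0 := (lead_coef p / m.+1%:R) *: 'X^(m.+1) : {poly rat}.
pose D := (lead_coef p / m.+1%:R) *: \poly_(k < m.+1) 'C(m.+1, k)%:R : {poly rat}.
have DE n : P0.[n.+1%:R] = P0.[n%:R] + D.[n%:R].
  rewrite /P0 /D !hornerZ !hornerXn -mulrDr horner_poly; congr (_ * _).
  rewrite -natr1 exprD1n big_ord_recr /= binn mulr1n addrC; congr (_ + _).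
  by apply: eq_bigr => k _; rewrite mulr_natl.
have lt_pD : (size (p - D)%R < size p)%N.
  rewrite sp ltnS; apply/leq_sizeP => k mk; rewrite coefB coefZ coef_poly.
  have [km|km] := leqP k m.
    have -> : k = m by apply/eqP; rewrite eqn_leq mk km.
    by rewrite ltnSn binSn divfK ?pnatr_eq0 // lead_coefE -/m subrr.
  by rewrite ltnS leqNgt km mulr0 subr0 nth_default // sp.
have [|P1 sP1 P1E] := IHd (p - D); first exact: leq_trans lt_pD _.
exists (P0 + P1) => [|n].
  rewrite (leq_trans (size_polyD _ _)) // geq_max (leq_trans sP1) ?andbT //.
    by rewrite (leq_trans (size_scale_leq _ _)) // size_polyXn sp.
  by rewrite ltnW.
elim: n => [|n IHn].
  by rewrite big_ord0 hornerD -P1E big_ord0 /P0 hornerZ hornerXn expr0n /= mulr0 addr0.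
rewrite big_ord_recr IHn !hornerD DE -!P1E big_ord_recr /= hornerD hornerN; ring.
Qed.

Definition conv (f g : nat -> rat) n := \sum_(i < n.+1) f i * g (n - i)%N.

(** Induction on the polynomial of the second factor: multiplying it by its variable n - i
    produces n times a convolution minus a convolution with the first factor multiplied by i. *)
Lemma pol_seq_conv s t f g : pol_seq s f -> pol_seq t g -> pol_seq (s + t) (conv f g).
Proof.
move=> fs [q qt gq].
have : pol_seq (s + size q) (conv f (fun n => q.[n%:R])).
  elim/poly_ind: q {g t qt gq} s f fs => [|q c IHq] s f fs.
    by apply: eq_pol_seq (pol_seq0 _) => n; rewrite /conv big1 // => i _; rewrite horner0 mulr0.
  have [->|nz] := eqVneq (q * 'X + c%:P) 0.
    by apply: eq_pol_seq (pol_seq0 _) => n; rewrite /conv big1 // => i _; rewrite horner0 mulr0.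
  have E n : n%:R * conv f (fun n => q.[n%:R]) n
       - conv (fun i => i%:R * f i) (fun n => q.[n%:R]) n
       + c * \sum_(i < n.+1) f i = conv f (fun n => (q * 'X + c%:P).[n%:R]) n.
    rewrite /conv !mulr_sumr -sumrB -big_split; apply: eq_bigr => i _ /=.
    have ni : (i <= n)%N by rewrite -ltnS.
    by rewrite hornerMXaddC (natrB _ ni); ring.
  apply: (eq_pol_seq E); have szq : (s + size (q * 'X + c%:P)%R = (s + size q).+1)%N \/
     q = 0 /\ (s + size (q * 'X + c%:P)%R = s.+1)%N.
    rewrite size_MXaddC; move: nz; have [->|q0] := eqVneq q 0.
      by rewrite mul0r add0r polyC_eq0 => /negPf -> /=; right; rewrite size_poly0 addn1.
    by move=> _; left; rewrite addnS.
  case: szq => [->|[q0 ->]].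
    apply: pol_seqD; last first.
      apply: pol_seqZ; apply: pol_seqW (pol_seq_sum fs); by rewrite ltnS leq_addr.
    apply: pol_seqB; first exact: pol_seqX (IHq _ _ fs).
    by rewrite -addSn; apply: IHq; apply: pol_seqX.
  apply: eq_pol_seq (pol_seqZ c (pol_seq_sum fs)) => n.
  have z h : conv h (fun n => q.[n%:R]) n = 0.
    by rewrite /conv big1 // => i _; rewrite q0 horner0 mulr0.
  by rewrite !z mulr0 subrr add0r.
move=> H; apply: pol_seqW (eq_pol_seq _ H); first by rewrite leq_add2l.
by move=> n; apply: eq_bigr => i _; rewrite gq.
Qed.

Lemma pol_seq_eq s f g : pol_seq s f -> pol_seq s g ->
  (forall n, (n < s)%N -> f n = g n) -> f =1 g.
Proof.
move=> fs gs fg; have [p ps pE] := pol_seqB fs gs.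
suff p0 : p = 0 by move=> n; apply/eqP; rewrite -subr_eq0 pE p0 horner0.
apply/eqP/negPn/negP => p0.
pose rs := [seq k%:R : rat | k <- iota 0 s].
have rp : all (root p) rs.
  apply/allP => _ /mapP[n nin ->]; rewrite rootE -pE fg ?subrr //.
  by move: nin; rewrite mem_iota.
have urs : uniq rs.
  by rewrite map_inj_uniq ?iota_uniq // => x y /eqP; rewrite eqr_nat => /eqP.
by have := max_poly_roots p0 rp urs; rewrite size_map size_iota ltnNge ps.
Qed.

(** * Sums over simplices *)

Section Simplices.
Variable V : nmodType.

(** The sum over the simplex x + y + z + d = J. *)
Definition simplex1 (w : nat -> nat -> nat -> nat -> V) J :=
  \sum_(x < J.+1) \sum_(y < (J - x).+1) \sum_(z < (J - x - y).+1)
     w x y z (J - x - y - z)%N.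

(** The sum over the lattice points of the simplex a + b + c + 2 e = J. *)
Definition simplex2 (w : nat -> nat -> nat -> nat -> V) J :=
  \sum_(e < J./2.+1) \sum_(a < (J - e.*2).+1) \sum_(b < (J - e.*2 - a).+1)
     w a b (J - e.*2 - a - b)%N e.

Lemma big_bij_in (I1 I2 : finType) (P1 : pred I1) (P2 : pred I2) (F : I1 -> V) h h' :
    (forall i, P1 i -> h (h' i) = i /\ P2 (h' i)) ->
    (forall j, P2 j -> h' (h j) = j /\ P1 (h j)) ->
  \sum_(i | P1 i) F i = \sum_(j | P2 j) F (h j).
Proof.
move=> H1 H2; rewrite (reindex_onto h h') => [|i /H1[] //].
apply: eq_bigl => j; apply/andP/idP => [[/H1[_ P2j] /eqP <-] //|/H2[-> ->]].
by rewrite eqxx.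
Qed.

Lemma widen_sum (F : nat -> V) m n : (m <= n)%N ->
  \sum_(i < m) F i = \sum_(i < n | (i < m)%N) F i.
Proof. by move=> mn; rewrite (big_ord_widen n F mn). Qed.

Lemma triple_sum N (P : 'I_N -> 'I_N -> pred 'I_N) (F : 'I_N -> 'I_N -> 'I_N -> V) :
  \sum_x \sum_y \sum_(z | P x y z) F x y z =
  \sum_(t : 'I_N * 'I_N * 'I_N | P t.1.1 t.1.2 t.2) F t.1.1 t.1.2 t.2.
Proof.
rewrite [RHS]big_mkcond -(pair_bigA _ (fun (xy : 'I_N * 'I_N) z =>
  if P xy.1 xy.2 z then F xy.1 xy.2 z else 0)) /=.
rewrite -(pair_bigA _ (fun x y => \sum_z if P x y z then F x y z else 0)) /=.
by apply: eq_bigr => x _; apply: eq_bigr => y _; rewrite big_mkcond.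
Qed.

Definition region (x y z J : nat) := [&& x + y <= J, x + z <= J & y + z <= J]%N.

(** The points with x + y + z <= J form the first simplex. For the others put
    e + 1 = x + y + z - J; as x - (e + 1) = J - y - z >= 0, and likewise for y and z, all three
    coordinates exceed e, and the reduced coordinates run over the second simplex. *)
Lemma region_split (W : nat -> nat -> nat -> V) J :
  \sum_(x < J.+1) \sum_(y < J.+1) \sum_(z < J.+1 | region x y z J) W x y z =
  simplex1 (fun x y z _ => W x y z) J +
  (if J is J'.+2 then simplex2 (fun a b c e => W (a + e.+1)%N (b + e.+1)%N (c + e.+1)%N) J'
   else 0).
Proof.
transitivity (\sum_(x < J.+1) \sum_(y < J.+1) \sum_(z < J.+1 | (x + y + z <= J)%N) W x y z
  + \sum_(x < J.+1) \sum_(y < J.+1) \sum_(z < J.+1 | region x y z J && (J < x + y + z)%N) W x y z).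
  rewrite -big_split; apply: eq_bigr => x _; rewrite -big_split; apply: eq_bigr => y _ /=.
  rewrite (bigID (fun z : 'I_J.+1 => x + y + z <= J)%N) /=; congr (_ + _).
    by apply: eq_bigl => z; rewrite /region; lia.
  by apply: eq_bigl => z; rewrite ltnNge.
congr (_ + _).
  apply: eq_bigr => x _; have xJ := ltn_ord x.
  rewrite (widen_sum (fun y => \sum_(z < (J - x - y).+1) W x y z) (n := J.+1)).
    rewrite [RHS]big_mkcond; apply: eq_bigr => y _; case: ifP => xy.
      rewrite (widen_sum (fun z => W x y z) (n := J.+1)); last by lia.
      by apply: eq_bigl => z; move: xy; rewrite !ltnS; lia.
    by rewrite big_pred0 // => z; move: xy; rewrite !ltnS; lia.
  by lia.
case: J => [|[|J]].
- by rewrite big1 // => x _; rewrite big1 // => y _; rewrite big_pred0 // => z; rewrite /region; lia.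
- by rewrite big1 // => x _; rewrite big1 // => y _; rewrite big_pred0 // => z; rewrite /region; lia.
pose N := J.+3.
transitivity (\sum_(e < N) \sum_(a < N) \sum_(b < N | (a + b + e.*2 <= J)%N)
    W (a + e.+1)%N (b + e.+1)%N (J - e.*2 - a - b + e.+1)%N); last first.
  rewrite /simplex2 (widen_sum (fun e => \sum_(a < (J - e.*2).+1) \sum_(b < (J - e.*2 - a).+1)
     W (a + e.+1)%N (b + e.+1)%N (J - e.*2 - a - b + e.+1)%N) (n := N)); last by rewrite /N; lia.
  rewrite [RHS]big_mkcond; apply: eq_bigr => e _; case: ifP => eJ.
    rewrite (widen_sum (fun a => \sum_(b < (J - e.*2 - a).+1)
       W (a + e.+1)%N (b + e.+1)%N (J - e.*2 - a - b + e.+1)%N) (n := N)); last by rewrite /N; lia.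
    rewrite [RHS]big_mkcond; apply: eq_bigr => a _; case: ifP => aJ.
      rewrite (widen_sum (fun b =>
        W (a + e.+1)%N (b + e.+1)%N (J - e.*2 - a - b + e.+1)%N) (n := N)); last by rewrite /N; lia.
      by apply: eq_bigl => b; lia.
    by rewrite big_pred0 // => b; lia.
  by rewrite big1 // => a _; rewrite big_pred0 // => b; lia.
rewrite !triple_sum.
(* Mutually inverse bijections on the two ranges; outside them inord gives junk values. *)
pose up (t : 'I_N * 'I_N * 'I_N) : 'I_N * 'I_N * 'I_N := let: (e, a, b) := t in
  (inord (a + e.+1), inord (b + e.+1), inord (J - e.*2 - a - b + e.+1)).
pose down (t : 'I_N * 'I_N * 'I_N) : 'I_N * 'I_N * 'I_N := let: (x, y, z) := t in
  (inord (x + y + z - N), inord (J.+2 - y - z), inord (J.+2 - x - z)).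
rewrite (@big_bij_in _ _ _ (fun t : 'I_N * 'I_N * 'I_N => (t.1.2 + t.2 + (t.1.1).*2 <= J)%N)
  _ up down).
- apply: eq_bigr => - [[e a] b] /= abe; rewrite /up /= !inordK //.
  + by move: abe; clear; case: e a b => [e _] [a _] [b _] /=; lia.
  + by move: abe; clear; lia.
  + by move: abe; clear; lia.
- move=> [[x y] z] /=; rewrite /region => H; rewrite /down /up {up down}.
  have [k1 k2 k3] : [/\ x + y + z - N < N, J.+2 - y - z < N & J.+2 - x - z < N]%N.
    by move: H; rewrite /N; clear; split; lia.
  rewrite /= !inordK //; split; last by move: H; rewrite /N; clear; lia.
  congr (_, _, _); apply: val_inj; rewrite /= inordK; move: H; rewrite /N; clear; lia.
move=> [[e a] b] /= H; rewrite /down /up {up down}.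
have [k1 k2 k3] : [/\ a + e.+1 < N, b + e.+1 < N & J - e.*2 - a - b + e.+1 < N]%N.
  by move: H; rewrite /N; clear; split; lia.
rewrite /= !inordK //; split; last by move: H; rewrite /region /N; clear; lia.
congr (_, _, _); apply: val_inj; rewrite /= inordK; move: H; rewrite /N; clear; lia.
Qed.
End Simplices.

(** * Sums of products of affine forms *)

(** Coefficients of an affine form in four variables. *)
Definition affine := (rat * rat * rat * rat * rat)%type.
Definition aff (l : affine) (x y z d : nat) : rat :=
  let: (c0, c1, c2, c3, c4) := l in
  c0 + c1 * x%:R + c2 * y%:R + c3 * z%:R + c4 * d%:R.

(** What is common to the two simplices: a linear summation functional [T] under which products of
    polynomials in the single variables become polynomials of the expected degree. *)
Section AffineProducts.
Variable T : (nat -> nat -> nat -> nat -> rat) -> nat -> rat.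
Hypothesis T_ext : forall w v, (forall x y z d, w x y z d = v x y z d) -> T w =1 T v.
Hypothesis TD : forall w v n, T (fun x y z d => w x y z d + v x y z d) n = T w n + T v n.
Hypothesis TZ : forall c w n, T (fun x y z d => c * w x y z d) n = c * T w n.
Hypothesis T_prod : forall s1 s2 s3 s4 f1 f2 f3 f4,
  pol_seq s1 f1 -> pol_seq s2 f2 -> pol_seq s3 f3 -> pol_seq s4 f4 ->
  pol_seq (s1 + s2 + s3 + s4) (T (fun x y z d => f1 x * f2 y * f3 z * f4 d)).

Lemma pol_seq_affine_prod (L : seq affine) s1 s2 s3 s4 f1 f2 f3 f4 :
  pol_seq s1 f1 -> pol_seq s2 f2 -> pol_seq s3 f3 -> pol_seq s4 f4 ->
  pol_seq (size L + (s1 + s2 + s3 + s4))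
    (T (fun x y z d => (\prod_(l <- L) aff l x y z d) * (f1 x * f2 y * f3 z * f4 d))).
Proof.
elim: L s1 s2 s3 s4 f1 f2 f3 f4 => [|[[[[c0 c1] c2] c3] c4] L IHL] s1 s2 s3 s4 f1 f2 f3 f4 h1 h2 h3 h4.
  apply: eq_pol_seq (T_prod h1 h2 h3 h4) => n; apply: T_ext => x y z d.
  by rewrite big_nil mul1r.
pose w g1 g2 g3 g4 x y z d := (\prod_(l <- L) aff l x y z d) * (g1 x * g2 y * g3 z * g4 d).
pose nX (f : nat -> rat) n := n%:R * f n.
apply: (@eq_pol_seq _ (fun n => c0 * T (w f1 f2 f3 f4) n + c1 * T (w (nX f1) f2 f3 f4) n
  + c2 * T (w f1 (nX f2) f3 f4) n + c3 * T (w f1 f2 (nX f3) f4) n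
  + c4 * T (w f1 f2 f3 (nX f4)) n)) => [n|].
  rewrite -!TZ -!TD; apply: T_ext => x y z d.
  by rewrite big_cons /w /nX /aff; ring.
have X s f : pol_seq s f -> pol_seq s.+1 (nX f) by apply: pol_seqX.
rewrite /= addSn; do 4?[apply: pol_seqD]; apply: pol_seqZ.
- by apply: pol_seqW (IHL _ _ _ _ _ _ _ _ h1 h2 h3 h4).
- by apply: pol_seqW (IHL _ _ _ _ _ _ _ _ (X _ _ h1) h2 h3 h4); lia.
- by apply: pol_seqW (IHL _ _ _ _ _ _ _ _ h1 (X _ _ h2) h3 h4); lia.
- by apply: pol_seqW (IHL _ _ _ _ _ _ _ _ h1 h2 (X _ _ h3) h4); lia.
by apply: pol_seqW (IHL _ _ _ _ _ _ _ _ h1 h2 h3 (X _ _ h4)); lia.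
Qed.
End AffineProducts.

Lemma pol_seq_const (c : rat) : pol_seq 1 (fun=> c).
Proof. by exists c%:P => [|n]; rewrite ?size_polyC_leq1 ?hornerC. Qed.

Lemma simplex1_prod f1 f2 f3 f4 J :
  simplex1 (fun x y z d => f1 x * f2 y * f3 z * f4 d) J = conv f1 (conv f2 (conv f3 f4)) J :> rat.
Proof.
rewrite /simplex1 /conv; apply: eq_bigr => x _; rewrite mulr_sumr.
apply: eq_bigr => y _; rewrite 2!mulr_sumr; apply: eq_bigr => z _.
by rewrite !mulrA.
Qed.

Lemma simplex2_prod f1 f2 f3 f4 r i : (r < 2)%N ->
  simplex2 (fun a b c e => f1 a * f2 b * f3 c * f4 e) (2 * i + r) =
  conv f4 (fun n => conv f1 (conv f2 f3) (2 * n + r)%N) i :> rat.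
Proof.
move=> r2; rewrite /simplex2 /conv.
have -> : (2 * i + r)./2 = i by lia.
apply: eq_bigr => e _.
have -> : (2 * i + r - e.*2 = 2 * (i - e) + r)%N by have := ltn_ord e; lia.
rewrite mulr_sumr; apply: eq_bigr => a _; rewrite 2!mulr_sumr; apply: eq_bigr => b _.
by ring.
Qed.

Lemma pol_seq_simplex1 L :
  pol_seq (size L + 4) (simplex1 (fun x y z d => \prod_(l <- L) aff l x y z d)).
Proof.
apply: (@eq_pol_seq _ (simplex1 (fun x y z d => (\prod_(l <- L) aff l x y z d) * (1 * 1 * 1 * 1)))).
  by move=> n; do 3!(apply: eq_bigr => ? _); rewrite !mulr1.
have c1 := pol_seq_const 1.
apply: (@pol_seq_affine_prod (@simplex1 rat) _ _ _ _ L 1 1 1 1 _ _ _ _ c1 c1 c1 c1).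
- by move=> w v wv n; do 3!(apply: eq_bigr => ? _).
- move=> w v n; rewrite /simplex1 -big_split; apply: eq_bigr => ? _.
  by rewrite -big_split; apply: eq_bigr => ? _; rewrite -big_split.
- move=> c w n; rewrite /simplex1 mulr_sumr; apply: eq_bigr => ? _.
  by rewrite mulr_sumr; apply: eq_bigr => ? _; rewrite mulr_sumr.
move=> s1 s2 s3 s4 f1 f2 f3 f4 h1 h2 h3 h4.
apply: (@eq_pol_seq _ (conv f1 (conv f2 (conv f3 f4)))).
  by move=> n; rewrite simplex1_prod.
by rewrite -!addnA; do 3!(apply: pol_seq_conv => //).
Qed.

Lemma pol_seq_simplex2 L r :
  pol_seq (size L + 4) (fun i => simplex2 (fun x y z d => \prod_(l <- L) aff l x y z d) (2 * i + r)).
Proof.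
have small q : (q < 2)%N ->
  pol_seq (size L + 4) (fun i => simplex2 (fun x y z d => \prod_(l <- L) aff l x y z d) (2 * i + q)).
  move=> q2; pose T w i : rat := simplex2 w (2 * i + q).
  apply: (@eq_pol_seq _ (T (fun x y z d => (\prod_(l <- L) aff l x y z d) * (1 * 1 * 1 * 1)))).
    by move=> n; do 3!(apply: eq_bigr => ? _); rewrite !mulr1.
  have c1 := pol_seq_const 1.
  apply: (@pol_seq_affine_prod T _ _ _ _ L 1 1 1 1 _ _ _ _ c1 c1 c1 c1).
  - by move=> w v wv n; do 3!(apply: eq_bigr => ? _).
  - move=> w v n; rewrite /T /simplex2 -big_split; apply: eq_bigr => ? _.
    by rewrite -big_split; apply: eq_bigr => ? _; rewrite -big_split.
  - move=> c w n; rewrite /T /simplex2 mulr_sumr; apply: eq_bigr => ? _.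
    by rewrite mulr_sumr; apply: eq_bigr => ? _; rewrite mulr_sumr.
  move=> s1 s2 s3 s4 f1 f2 f3 f4 h1 h2 h3 h4.
  apply: (@eq_pol_seq _ (conv f4 (fun n => conv f1 (conv f2 f3) (2 * n + q)%N))).
    by move=> n; rewrite /T simplex2_prod.
  rewrite addnC; apply: pol_seq_conv => //; apply: pol_seq_affine.
  by rewrite -addnA; do 2!(apply: pol_seq_conv => //).
have r2 : (r %% 2 < 2)%N by rewrite ltn_mod.
apply: eq_pol_seq (pol_seq_affine 1 (r %/ 2) (small _ r2)) => n.
congr simplex2; have := divn_eq r 2; lia.
Qed.

(** * Blocks of the weight multiplicities *)

(** The number of monomials of degree k in three variables. *)
Definition mult (k : nat) : nat := 'C(k.+2, 2).

Lemma mult_twice k : (2 * mult k = k.+1 * k.+2)%N.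
Proof. by rewrite /mult -mul_bin_diag bin1 mulnC. Qed.

(** [mult (t - d)] for d <= t; as the polynomial of [mult] vanishes at -1 and -2, this remains
    polynomial in t when d is 1 or 2. *)
Definition tmult (d t : nat) : nat := 'C(t + 2 - d, 2).

Lemma tmult_twice d t : (d <= 2)%N ->
  ((2 * tmult d t)%N%:R : rat) = (t%:R + (1 - d%:R)) * (t%:R + (2 - d%:R)).
Proof.
move=> d2; have [k0|k0] := posnP (t + 2 - d).
  rewrite /tmult k0 bin0n muln0.
  have [-> ->] : d = 2%N /\ t = 0%N by lia.
  by ring.
rewrite /tmult; have [k kE] : exists k, (t + 2 - d = k.+1)%N by exists (t + 1 - d)%N; lia.
have -> : (t%:R : rat) = k%:R + d%:R - 1.
  have tE : (t + 2 = k + 1 + d)%N by lia.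
  have := congr1 (fun n => n%:R : rat) tE; rewrite !natrD => E.
  by apply: (@addIr _ 2); rewrite E; ring.
by rewrite /tmult kE -mul_bin_diag bin1; case: k {kE} => [|k]; rewrite ?natrM -?natr1 /=; ring.
Qed.

Section Block.
Variables (e1 e2 e3 d1 d2 d3 : nat).

Definition blockW (x y z n1 n2 n3 : nat) : nat :=
  (mult (2 * x + e1) * mult (2 * y + e2) * mult (2 * z + e3)
   * (tmult d1 n1 * tmult d2 n2 * tmult d3 n3))%N.

(** The contribution of the off-diagonal degrees 2 x + e1, 2 y + e2, 2 z + e3 of fixed parities; the
    diagonal degrees are the complements to J, diminished by d1, d2, d3. *)
Definition block J : nat :=
  (\sum_(x < J.+1) \sum_(y < J.+1) \sum_(z < J.+1 | region x y z J)
     blockW x y z (J - x - y) (J - x - z) (J - y - z))%N.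

Definition w1 x y z d := blockW x y z (z + d) (y + d) (x + d).
Definition w2 a b c e := blockW (a + e.+1) (b + e.+1) (c + e.+1) c b a.

(** On each simplex the complements to J are sums of the coordinates, so that the summand no longer
    depends on J. *)
Lemma block_split J : block J =
  (simplex1 w1 J + (if J is J'.+2 then simplex2 w2 J' else 0))%N.
Proof.
rewrite /block (region_split (V := nat)
  (fun x y z => blockW x y z (J - x - y) (J - x - z) (J - y - z))); congr (_ + _)%N.
  apply: eq_bigr => x _; apply: eq_bigr => y _; apply: eq_bigr => z _.
  have := ltn_ord x; have := ltn_ord y; have := ltn_ord z; rewrite /w1 => hz hy hx.
  by congr blockW; lia.
case: J => [|[|J]] //.
apply: eq_bigr => e _; apply: eq_bigr => a _; apply: eq_bigr => b _.
have := ltn_ord e; have := ltn_ord a; have := ltn_ord b; rewrite /w2 => hb ha he.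
by congr blockW; lia.
Qed.

Lemma natr_simplex1 c w J : ((c * simplex1 w J)%N%:R : rat) =
  simplex1 (fun x y z d => (c * w x y z d)%N%:R) J.
Proof.
rewrite natrM /simplex1; do 3!(rewrite raddf_sum mulr_sumr; apply: eq_bigr => ? _).
by rewrite natrM.
Qed.

Lemma natr_simplex2 c w J : ((c * simplex2 w J)%N%:R : rat) =
  simplex2 (fun x y z d => (c * w x y z d)%N%:R) J.
Proof.
rewrite natrM /simplex2; do 3!(rewrite raddf_sum mulr_sumr; apply: eq_bigr => ? _).
by rewrite natrM.
Qed.

Hypotheses (hd1 : (d1 <= 2)%N) (hd2 : (d2 <= 2)%N) (hd3 : (d3 <= 2)%N).

Lemma blockW_prod x y z n1 n2 n3 : ((64 * blockW x y z n1 n2 n3)%N%:R : rat) =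
  (2 * x%:R + (e1%:R + 1)) * (2 * x%:R + (e1%:R + 2)) *
  ((2 * y%:R + (e2%:R + 1)) * (2 * y%:R + (e2%:R + 2))) *
  ((2 * z%:R + (e3%:R + 1)) * (2 * z%:R + (e3%:R + 2))) *
  ((n1%:R + (1 - d1%:R)) * (n1%:R + (2 - d1%:R)) *
   ((n2%:R + (1 - d2%:R)) * (n2%:R + (2 - d2%:R))) *
   ((n3%:R + (1 - d3%:R)) * (n3%:R + (2 - d3%:R)))).
Proof.
have m2 k e : ((2 * mult (2 * k + e))%N%:R : rat) =
    (2 * k%:R + (e%:R + 1)) * (2 * k%:R + (e%:R + 2)).
  by rewrite mult_twice natrM -!natr1 natrD natrM; ring.
rewrite -!m2 -!tmult_twice // -!natrM; congr (_%:R).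
rewrite /blockW; set m1 := mult _; set m3 := mult _; set m4 := mult _; clear; lia.
Qed.

(** The affine factors of 64 times the summand over the first simplex; the factor 64 clears the
    denominators of six binomial coefficients. *)
Definition list1 : seq affine :=
  [:: (e1%:R + 1, 2, 0, 0, 0); (e1%:R + 2, 2, 0, 0, 0);
      (e2%:R + 1, 0, 2, 0, 0); (e2%:R + 2, 0, 2, 0, 0);
      (e3%:R + 1, 0, 0, 2, 0); (e3%:R + 2, 0, 0, 2, 0);
      (1 - d1%:R, 0, 0, 1, 1); (2 - d1%:R, 0, 0, 1, 1);
      (1 - d2%:R, 0, 1, 0, 1); (2 - d2%:R, 0, 1, 0, 1);
      (1 - d3%:R, 1, 0, 0, 1); (2 - d3%:R, 1, 0, 0, 1)].

Definition list2 : seq affine :=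
  [:: (e1%:R + 3, 2, 0, 0, 2); (e1%:R + 4, 2, 0, 0, 2);
      (e2%:R + 3, 0, 2, 0, 2); (e2%:R + 4, 0, 2, 0, 2);
      (e3%:R + 3, 0, 0, 2, 2); (e3%:R + 4, 0, 0, 2, 2);
      (1 - d1%:R, 0, 0, 1, 0); (2 - d1%:R, 0, 0, 1, 0);
      (1 - d2%:R, 0, 1, 0, 0); (2 - d2%:R, 0, 1, 0, 0);
      (1 - d3%:R, 1, 0, 0, 0); (2 - d3%:R, 1, 0, 0, 0)].

Lemma w1_prod x y z d : ((64 * w1 x y z d)%N%:R : rat) = \prod_(l <- list1) aff l x y z d.
Proof. rewrite /w1 blockW_prod !natrD /list1 !big_cons big_nil /aff; ring. Qed.

Lemma w2_prod x y z d : ((64 * w2 x y z d)%N%:R : rat) = \prod_(l <- list2) aff l x y z d.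
Proof. rewrite /w2 blockW_prod !natrD -!natr1 /list2 !big_cons big_nil /aff; ring. Qed.

(** Twelve affine factors and four coordinates make the size at most 16. Starting from J = 2 avoids
    the case distinction in [block_split]. *)
Lemma pol_seq_block r : pol_seq 16 (fun i => (64 * block (2 * i + (2 + r)))%N%:R).
Proof.
apply: (@eq_pol_seq _ (fun i =>
    simplex1 (fun x y z d => \prod_(l <- list1) aff l x y z d) (2 * i + (2 + r)) +
    simplex2 (fun x y z d => \prod_(l <- list2) aff l x y z d) (2 * i + r))) => [i|].
  rewrite block_split (_ : 2 * i + (2 + r) = (2 * i + r).+2)%N; last by lia.
  rewrite mulnDr natrD natr_simplex1 natr_simplex2; congr (_ + _).
    by do 3!(apply: eq_bigr => ? _); rewrite w1_prod.
  by do 3!(apply: eq_bigr => ? _); rewrite w2_prod.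
apply: pol_seqD; last exact: (pol_seq_simplex2 list2 r).
exact: (pol_seq_affine 2 (2 + r) (pol_seq_simplex1 list1)).
Qed.
End Block.

(** * Evaluation of the blocks by convolution *)

Section Exchange.
Variable V : nmodType.

Lemma exchange_triangle (G : nat -> nat -> V) m :
  \sum_(y < m.+1) \sum_(d < (m - y).+1) G y d = \sum_(d < m.+1) \sum_(y < (m - d).+1) G y d.
Proof.
have widen (H : nat -> V) (y : 'I_m.+1) :
    \sum_(d < (m - y).+1) H d = \sum_(d < m.+1 | (d + y <= m)%N) H d.
  rewrite (widen_sum H (n := m.+1)); last by lia.
  by apply: eq_bigl => d; have := ltn_ord y; lia.
under eq_bigr => y _ do rewrite widen.
under [RHS]eq_bigr => d _ do rewrite (widen (fun y => G y d)).
rewrite (exchange_big_dep xpredT) //=; apply: eq_bigr => d _.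
by apply: eq_bigl => y; rewrite addnC.
Qed.

(** With d outermost, the inner sum is a convolution whenever the summand is, for each d, a product
    of functions of x, y and z, as it is for the blocks. *)
Lemma simplex1_outer (w : nat -> nat -> nat -> nat -> V) J :
  simplex1 w J = \sum_(d < J.+1) \sum_(x < (J - d).+1) \sum_(y < (J - d - x).+1)
    w x y (J - d - x - y)%N d.
Proof.
rewrite -(exchange_triangle (fun x d => \sum_(y < (J - d - x).+1) w x y (J - d - x - y)%N d)).
apply: eq_bigr => x _.
have -> : \sum_(d < (J - x).+1) \sum_(y < (J - d - x).+1) w x y (J - d - x - y)%N d =
    \sum_(d < (J - x).+1) \sum_(y < (J - x - d).+1) w x y (J - x - d - y)%N d.
  by apply: eq_bigr => d _; rewrite (subnAC J d x).
rewrite -(exchange_triangle (fun y d => w x y (J - x - d - y)%N d)).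
apply: eq_bigr => y _.
rewrite (reindex_inj rev_ord_inj) /=; apply: eq_bigr => z _.
rewrite subSS; congr w; have := ltn_ord z; lia.
Qed.
End Exchange.

(** Lists of binary natural numbers, read as truncated power series. *)
Section BinarySeries.
Notation N := BinNums.N.
Notation N0 := BinNums.N0.
Notation "a +N b" := (BinNat.N.add a b) (at level 50, left associativity).
Notation "a *N b" := (BinNat.N.mul a b) (at level 40, left associativity).
Notation to_nat := BinNat.N.to_nat.

Lemma to_nat_add a b : to_nat (a +N b) = (to_nat a + to_nat b)%N.
Proof. exact: Nnat.N2Nat.inj_add. Qed.
Lemma to_nat_mul a b : to_nat (a *N b) = (to_nat a * to_nat b)%N.
Proof. exact: Nnat.N2Nat.inj_mul. Qed.
Lemma to_natK n : to_nat (BinNat.N.of_nat n) = n.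
Proof. exact: Nnat.Nat2N.id. Qed.

Definition ncoef (l : seq N) (i : nat) : nat := to_nat (nth N0 l i).

Fixpoint addL (a b : seq N) : seq N :=
  match a, b with
  | x :: a', y :: b' => (x +N y) :: addL a' b'
  | [::], _ => b
  | _, [::] => a
  end.

Lemma coef_addL a b i : ncoef (addL a b) i = (ncoef a i + ncoef b i)%N.
Proof.
elim: a b i => [|x a IHa] [|y b] [|i]; rewrite /ncoef /= ?nth_nil ?addn0 //.
- exact: to_nat_add.
- exact: IHa.
Qed.

Fixpoint mulL (a b : seq N) : seq N :=
  match a, b with
  | x :: a', y :: b' => (x *N y) :: mulL a' b'
  | _, _ => [::]
  end.

Lemma coef_mulL a b i : ncoef (mulL a b) i = (ncoef a i * ncoef b i)%N.
Proof.
elim: a b i => [|x a IHa] [|y b] [|i]; rewrite /ncoef /= ?nth_nil ?muln0 //.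
- exact: to_nat_mul.
- exact: IHa.
Qed.

Lemma size_mulL a b : size (mulL a b) = minn (size a) (size b).
Proof. by elim: a b => [|x a IHa] [|y b] //=; rewrite ?min0n ?minn0 // IHa minnSS. Qed.

Fixpoint dotL (a b : seq N) : N :=
  match a, b with
  | x :: a', y :: b' => x *N y +N dotL a' b'
  | _, _ => N0
  end.

Lemma dotLE a b : to_nat (dotL a b) = (\sum_(i < size b) ncoef a i * ncoef b i)%N.
Proof.
elim: b a => [|y b IHb] [|x a]; rewrite ?big_ord0 //=.
  by rewrite big1 // => i _; rewrite {1}/ncoef nth_nil.
by rewrite to_nat_add to_nat_mul IHb big_ord_recl.
Qed.

(** [r] is the part of the second factor already read, in reverse order. *)
Fixpoint convL (a r b : seq N) : seq N :=
  if b is x :: b' then dotL a (x :: r) :: convL a (x :: r) b' else [::].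

Lemma coef_convL a b t : (t < size b)%N ->
  ncoef (convL a [::] b) t = (\sum_(i < t.+1) ncoef a i * ncoef b (t - i))%N.
Proof.
suff H r : (t < size b)%N -> ncoef (convL a r b) t =
    (\sum_(i < size r + t.+1) ncoef a i * ncoef (catrev (take t.+1 b) r) i)%N.
  move=> tb; rewrite H //= add0n; apply: eq_bigr => i _; congr (_ * _)%N.
  have it := ltn_ord i.
  rewrite /ncoef -/(rev _) nth_rev ?size_take_min ?(minn_idPl tb) //.
  by rewrite nth_take subSS // ltnS leq_subr.
elim: b t r => // x b IHb [|t] r /=; rewrite ?ltnS => tb.
  by rewrite /ncoef /= dotLE /= take0 addn1.
by rewrite [LHS](IHb t (x :: r)) //= addSnnS.
Qed.

Lemma size_convL a r b : size (convL a r b) = size b.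
Proof. by elim: b r => //= x b IHb r; rewrite IHb. Qed.

Definition conv3 a b c := convL a [::] (convL b [::] c).

Lemma coef_conv3 a b c t : (t < size c)%N -> ncoef (conv3 a b c) t =
  (\sum_(x < t.+1) \sum_(y < (t - x).+1) ncoef a x * (ncoef b y * ncoef c (t - x - y)))%N.
Proof.
move=> tc; rewrite coef_convL ?size_convL //; apply: eq_bigr => x _.
by rewrite coef_convL ?big_distrr // (leq_ltn_trans _ tc) // leq_subr.
Qed.

Lemma coef_behead a i : ncoef (behead a) i = ncoef a i.+1.
Proof. by rewrite /ncoef nth_behead. Qed.

(** Horner scheme in the variable of the power series: the d-th step contributes the product of
    three series, shifted by d. *)
Fixpoint table1 (p1 p2 p3 q1 q2 q3 : seq N) (fuel : nat) : seq N :=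
  if fuel is f.+1 then
    addL (conv3 (mulL p1 q3) (mulL p2 q2) (mulL p3 q1))
      (N0 :: table1 p1 p2 p3 (behead q1) (behead q2) (behead q3) f)
  else [::].

Lemma coef_table1 p1 p2 p3 q1 q2 q3 n J : (J < n)%N ->
    (J < size p3)%N -> (J < size q1)%N ->
  ncoef (table1 p1 p2 p3 q1 q2 q3 n) J =
  (\sum_(d < J.+1) \sum_(x < (J - d).+1) \sum_(y < (J - d - x).+1)
     ncoef p1 x * ncoef p2 y * ncoef p3 (J - d - x - y) *
     (ncoef q1 (J - d - x - y + d) * ncoef q2 (y + d) * ncoef q3 (x + d)))%N.
Proof.
elim: n q1 q2 q3 J => // n IHn q1 q2 q3 J Jn Jp Jq.
rewrite /= coef_addL big_ord_recl coef_conv3; last by rewrite size_mulL leq_min Jp.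
congr (_ + _)%N.
  rewrite subn0; apply: eq_bigr => x _; apply: eq_bigr => y _.
  by rewrite !coef_mulL !addn0; ring.
case: J Jn Jp Jq => [|J] Jn Jp Jq; first by rewrite big_ord0.
rewrite -[ncoef _ _]/(ncoef (table1 _ _ _ _ _ _ n) J) IHn //; last 2 first.
- exact: ltnW.
- by rewrite size_behead; case: (size q1) Jq.
apply: eq_bigr => d _; rewrite /bump /= subSS; apply: eq_bigr => x _.
by apply: eq_bigr => y _; rewrite !coef_behead !addnS.
Qed.

(** As [table1], with shifts by 2 e. *)
Fixpoint table2 (p1 p2 p3 q1 q2 q3 : seq N) (fuel : nat) : seq N :=
  if fuel is f.+1 then
    addL (conv3 (mulL (behead p1) q3) (mulL (behead p2) q2) (mulL (behead p3) q1))
      (N0 :: N0 :: table2 (behead p1) (behead p2) (behead p3) q1 q2 q3 f)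
  else [::].

Lemma coef_table2 p1 p2 p3 q1 q2 q3 n J : (J./2 < n)%N ->
    (J.+1 < size p3)%N -> (J < size q1)%N ->
  ncoef (table2 p1 p2 p3 q1 q2 q3 n) J =
  (\sum_(e < J./2.+1) \sum_(a < (J - e.*2).+1) \sum_(b < (J - e.*2 - a).+1)
     ncoef p1 (a + e.+1) * ncoef p2 (b + e.+1) * ncoef p3 (J - e.*2 - a - b + e.+1) *
     (ncoef q1 (J - e.*2 - a - b) * ncoef q2 b * ncoef q3 a))%N.
Proof.
elim: n p1 p2 p3 J => // n IHn p1 p2 p3 J Jn Jp Jq.
have sp : size (behead p3) = (size p3).-1 by rewrite size_behead.
rewrite /= coef_addL big_ord_recl coef_conv3; last first.
  by rewrite size_mulL leq_min sp Jq andbT -ltnS prednK // (leq_trans _ Jp).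
congr (_ + _)%N.
  rewrite double0 subn0; apply: eq_bigr => x _; apply: eq_bigr => y _.
  by rewrite !coef_mulL !coef_behead !addn1; ring.
case: J Jn Jp Jq => [|[|J]] Jn Jp Jq; rewrite ?big_ord0 //.
rewrite -[ncoef _ _]/(ncoef (table2 _ _ _ _ _ _ n) J) IHn //; last 2 first.
- by rewrite sp; lia.
- by lia.
apply: eq_bigr => d _; rewrite /bump /= doubleS !subSS; apply: eq_bigr => x _.
by apply: eq_bigr => y _; rewrite !coef_behead !addnS.
Qed.

Definition pronicN (k : nat) : N := BinNat.N.of_nat k *N BinNat.N.of_nat k.-1.

Lemma pronicNE k : to_nat (pronicN k) = (2 * 'C(k, 2))%N.
Proof. by rewrite to_nat_mul !to_natK -mul_bin_diag bin1. Qed.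

Definition multL e n := mkseq (fun k => pronicN (2 * k + e).+2) n.
Definition tmultL d n := mkseq (fun t => pronicN (t + 2 - d)) n.

Lemma coef_multL e n k : (k < n)%N -> ncoef (multL e n) k = (2 * mult (2 * k + e))%N.
Proof. by move=> kn; rewrite /ncoef nth_mkseq // pronicNE. Qed.

Lemma coef_tmultL d n k : (k < n)%N -> ncoef (tmultL d n) k = (2 * tmult d k)%N.
Proof. by move=> kn; rewrite /ncoef nth_mkseq // pronicNE. Qed.

Definition blockL n e1 e2 e3 d1 d2 d3 : seq N :=
  let p1 := multL e1 n in let p2 := multL e2 n in let p3 := multL e3 n in
  let q1 := tmultL d1 n in let q2 := tmultL d2 n in let q3 := tmultL d3 n in
  addL (table1 p1 p2 p3 q1 q2 q3 n) (N0 :: N0 :: table2 p1 p2 p3 q1 q2 q3 n./2).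

Lemma coef_blockL n e1 e2 e3 d1 d2 d3 J : (J < n)%N ->
  ncoef (blockL n e1 e2 e3 d1 d2 d3) J = (64 * block e1 e2 e3 d1 d2 d3 J)%N.
Proof.
move=> Jn; rewrite block_split mulnDr coef_addL; congr (_ + _)%N.
  rewrite coef_table1 ?size_mkseq // simplex1_outer big_distrr; apply: eq_bigr => d _.
  rewrite big_distrr; apply: eq_bigr => x _; rewrite big_distrr; apply: eq_bigr => y _ /=.
  have dJ := ltn_ord d; have xJ := ltn_ord x; have yJ := ltn_ord y.
  rewrite !coef_multL ?coef_tmultL; try lia.
  by rewrite /w1 /blockW; ring.
case: J Jn => [|[|J]] // Jn.
rewrite -[ncoef _ _]/(ncoef (table2 _ _ _ _ _ _ _) J) coef_table2 ?size_mkseq //; try lia.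
rewrite /simplex2 big_distrr; apply: eq_bigr => d _.
rewrite big_distrr; apply: eq_bigr => x _; rewrite big_distrr; apply: eq_bigr => y _ /=.
have dJ := ltn_ord d; have xJ := ltn_ord x; have yJ := ltn_ord y.
rewrite !coef_multL ?coef_tmultL; try lia.
by rewrite /w2 /blockW; ring.
Qed.
End BinarySeries.

(** * Finitely many values of the blocks *)

Fixpoint eqL (k : nat) (a b : seq BinNums.N) : bool :=
  if k is k'.+1 then
    BinNat.N.eqb (head BinNums.N0 a) (head BinNums.N0 b) && eqL k' (behead a) (behead b)
  else true.

Lemma eqLP k a b : eqL k a b -> forall i, (i < k)%N -> ncoef a i = ncoef b i.
Proof.
elim: k a b => // k IHk a b /= /andP[/BinNat.N.eqb_eq ab /IHk H] [|i] ik.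
  by rewrite /ncoef !nth0 ab.
by rewrite -!coef_behead H.
Qed.

Fixpoint ffactN (n m : nat) : BinNums.N :=
  if m is k.+1 then BinNat.N.mul (ffactN n k) (BinNat.N.of_nat (n - k))
  else BinNums.Npos BinNums.xH.

Lemma ffactNE n m : BinNat.N.to_nat (ffactN n m) = (n ^_ m)%N.
Proof. by elim: m => //= m IHm; rewrite to_nat_mul IHm to_natK ffactnSr. Qed.

(** The weight multiplicities with positive and with negative sign, see [weight_counts]. *)
Definition plus_blocks j := (block 0 0 0 0 0 0 j + block 1 1 1 1 1 1 j
  + (block 0 0 1 0 2 2 j.+1 + block 1 1 0 0 1 1 j)
  + (block 1 0 0 0 0 1 j + block 0 1 1 0 0 2 j))%N.

Definition minus_blocks j := (block 1 0 0 0 1 0 j + block 0 1 1 0 1 1 j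
  + (block 0 1 0 0 0 1 j + block 1 0 1 0 1 1 j)
  + (block 0 0 0 0 1 2 j.+1 + block 1 1 1 0 1 2 j))%N.

(** The coefficients of (1 + s^2 + s^4) / (1 - s)^10: the truncation to 0 of the binomial
    coefficients for small j accounts for the shifts by 2 and 4. *)
Definition hilbert_coef j := ('C(j + 9, 9) + 'C(j + 7, 9) + 'C(j + 5, 9))%N.

Definition scaleL f (a : seq BinNums.N) := map (BinNat.N.mul f) a.

Lemma coef_scaleL f a i : ncoef (scaleL f a) i = (BinNat.N.to_nat f * ncoef a i)%N.
Proof.
rewrite /ncoef; have [ia|ia] := ltnP i (size a).
  by rewrite (nth_map BinNums.N0) // to_nat_mul.
by rewrite !nth_default ?size_map // muln0.
Qed.

Definition plusL n : seq BinNums.N :=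
  addL (addL (addL (blockL n 0 0 0 0 0 0) (blockL n 1 1 1 1 1 1))
             (addL (behead (blockL n 0 0 1 0 2 2)) (blockL n 1 1 0 0 1 1)))
       (addL (blockL n 1 0 0 0 0 1) (blockL n 0 1 1 0 0 2)).

Definition minusL n : seq BinNums.N :=
  addL (addL (addL (blockL n 1 0 0 0 1 0) (blockL n 0 1 1 0 1 1))
             (addL (blockL n 0 1 0 0 0 1) (blockL n 1 0 1 0 1 1)))
       (addL (behead (blockL n 0 0 0 0 1 2)) (blockL n 1 1 1 0 1 2)).

Definition hilbertL n : seq BinNums.N :=
  mkseq (fun j => BinNat.N.add (BinNat.N.add (ffactN (j + 9) 9) (ffactN (j + 7) 9))
                    (ffactN (j + 5) 9)) n.

Lemma coef_plusL n j : (j.+1 < n)%N -> ncoef (plusL n) j = (64 * plus_blocks j)%N.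
Proof.
move=> jn; have jn' := ltnW jn.
by rewrite /plusL 5!coef_addL coef_behead !coef_blockL // /plus_blocks !mulnDr.
Qed.

Lemma coef_minusL n j : (j.+1 < n)%N -> ncoef (minusL n) j = (64 * minus_blocks j)%N.
Proof.
move=> jn; have jn' := ltnW jn.
by rewrite /minusL 5!coef_addL coef_behead !coef_blockL // /minus_blocks !mulnDr.
Qed.

Lemma coef_hilbertL n j : (j < n)%N -> ncoef (hilbertL n) j = (hilbert_coef j * 9`!)%N.
Proof.
move=> jn; rewrite /ncoef nth_mkseq // !to_nat_add !ffactNE.
by rewrite -!bin_ffact /hilbert_coef !mulnDl.
Qed.

(** Falling factorials replace the binomial coefficients in [hilbert_coef], at the cost of the
    factor 9!; the factor 64 comes with [blockL]. *)
Definition blocks_check n k : bool :=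
  eqL k (scaleL (ffactN 9 9) (plusL n))
    (addL (scaleL (ffactN 9 9) (minusL n)) (scaleL (BinNat.N.of_nat 64) (hilbertL n))).

Lemma blocks_checkP n k j : blocks_check n k -> (j < k)%N -> (j.+1 < n)%N ->
  plus_blocks j = (minus_blocks j + hilbert_coef j)%N.
Proof.
move=> C jk jn; have := eqLP C jk.
rewrite coef_addL 3!coef_scaleL coef_plusL // coef_minusL // (coef_hilbertL (ltnW jn)).
rewrite ffactNE -bin_ffact binn mul1n to_natK.
have := fact_gt0 9; move: (9`!) => F F0 E.
apply/eqP; rewrite -(eqn_pmul2l (_ : 0 < F * 64)%N) ?muln_gt0 ?F0 //; apply/eqP.
rewrite mulnDr -!mulnA E; congr (_ + _)%N; by clear; nia.
Qed.

Lemma blocks_small j : (j < 34)%N -> plus_blocks j = (minus_blocks j + hilbert_coef j)%N.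
Proof.
have C : blocks_check 35 34 by vm_compute.
by move=> j34; apply: (blocks_checkP C).
Qed.

(** * The identity between the blocks *)

Lemma pol_seq_binomial m : pol_seq m.+1 (fun n => 'C(n, m)%:R).
Proof.
apply: (@eq_pol_seq _ (fun n => (m`!%:R)^-1 * (n ^_ m)%:R)) => [n|].
  by rewrite -bin_ffact natrM mulrC mulfK // pnatr_eq0 -lt0n fact_gt0.
apply: pol_seqZ; elim: m => [|m IHm].
  by exists 1 => [|n]; rewrite ?size_poly1 // ffactn0 hornerC.
apply: (@eq_pol_seq _ (fun n => n%:R * (n ^_ m)%:R - m%:R * (n ^_ m)%:R)) => [n|].
  rewrite ffactnSr natrM; have [mn|nm] := leqP m n.
    by rewrite natrB //; ring.
  by rewrite ffact_small //; ring.
apply: pol_seqB; first exact: pol_seqX.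
by apply: pol_seqZ; apply: pol_seqW IHm.
Qed.

Lemma pol_seq_hilbert r : pol_seq 16 (fun i => (64 * hilbert_coef (2 * i + r))%N%:R).
Proof.
have h k : pol_seq 16 (fun i => 'C(2 * i + r + k, 9)%:R).
  apply: (@eq_pol_seq _ (fun i => 'C(2 * i + (r + k), 9)%:R)) => [i|].
    by rewrite addnA.
  by apply: (pol_seqW (_ : 10 <= 16)%N) => //; apply: (pol_seq_affine 2 (r + k) (pol_seq_binomial 9)).
apply: (@eq_pol_seq _ (fun i => 64%:R * ('C(2 * i + r + 9, 9)%:R + 'C(2 * i + r + 7, 9)%:R
   + 'C(2 * i + r + 5, 9)%:R))) => [i|].
  by rewrite natrM /hilbert_coef !natrD.
by apply: pol_seqZ; do 2?[apply: pol_seqD].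
Qed.

Lemma pol_seq_plus r : pol_seq 16 (fun i => (64 * plus_blocks (2 * i + (2 + r)))%N%:R).
Proof.
apply: (@eq_pol_seq _ (fun i => (64 * block 0 0 0 0 0 0 (2 * i + (2 + r)))%N%:R
  + (64 * block 1 1 1 1 1 1 (2 * i + (2 + r)))%N%:R
  + ((64 * block 0 0 1 0 2 2 (2 * i + (2 + r.+1)))%N%:R
     + (64 * block 1 1 0 0 1 1 (2 * i + (2 + r)))%N%:R)
  + ((64 * block 1 0 0 0 0 1 (2 * i + (2 + r)))%N%:R
     + (64 * block 0 1 1 0 0 2 (2 * i + (2 + r)))%N%:R))) => [i|].
  by rewrite -!natrD -!mulnDr !addnS.
by do ![apply: pol_seqD]; apply: pol_seq_block.
Qed.

Lemma pol_seq_minus r : pol_seq 16 (fun i => (64 * minus_blocks (2 * i + (2 + r)))%N%:R).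
Proof.
apply: (@eq_pol_seq _ (fun i => (64 * block 1 0 0 0 1 0 (2 * i + (2 + r)))%N%:R
  + (64 * block 0 1 1 0 1 1 (2 * i + (2 + r)))%N%:R
  + ((64 * block 0 1 0 0 0 1 (2 * i + (2 + r)))%N%:R
     + (64 * block 1 0 1 0 1 1 (2 * i + (2 + r)))%N%:R)
  + ((64 * block 0 0 0 0 1 2 (2 * i + (2 + r.+1)))%N%:R
     + (64 * block 1 1 1 0 1 2 (2 * i + (2 + r)))%N%:R))) => [i|].
  by rewrite -!natrD -!mulnDr !addnS.
by do ![apply: pol_seqD]; apply: pol_seq_block.
Qed.

(** On each parity class both sides are polynomials of size at most 16 in i, where j = 2 i + 2 + r,
    hence determined by i < 16, that is by j < 34. *)
Theorem blocks_identity j : plus_blocks j = (minus_blocks j + hilbert_coef j)%N.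
Proof.
have [j2|j2] := ltnP j 2; first by apply: blocks_small; apply: leq_trans j2 _.
(* The cases j < 2 lie below the range of the polynomials. *)
pose i := (j - 2)./2; pose r := ((j - 2) - i.*2)%N.
have jE : j = (2 * i + (2 + r))%N by rewrite /r /i; lia.
have r2 : (r < 2)%N by rewrite /r /i; lia.
have := @pol_seq_eq _ _ _ (pol_seq_plus r) (pol_seqD (pol_seq_minus r) (pol_seq_hilbert (2 + r))).
move=> /(_ _ i) H; apply/eqP; rewrite -(eqn_pmul2l (_ : 0 < 64)%N) //.
rewrite -(eqr_nat rat) mulnDr natrD jE; apply/eqP/H => n n16.
by rewrite -natrD -mulnDr -blocks_small //; lia.
Qed.

(** * Weight multiplicities as sums of blocks *)

Section DegreeCounts.
Local Open Scope nat_scope.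
Definition msum (N : nat) (F : nat -> nat) : nat := \sum_(k < N) mult k * F k.

Lemma eq_msum N F G : F =1 G -> msum N F = msum N G.
Proof. by move=> FG; apply: eq_bigr => k _; rewrite FG. Qed.

Lemma msumZ N c F : msum N (fun k => c * F k) = c * msum N F.
Proof. by rewrite /msum big_distrr; apply: eq_bigr => k _ /=; rewrite mulnCA. Qed.

Lemma exchange_msum N F :
  msum N (fun k => msum N (F k)) = msum N (fun l => msum N (fun k => F k l)).
Proof.
rewrite /msum; under eq_bigr => k _ do rewrite big_distrr.
rewrite exchange_big; apply: eq_bigr => l _ /=; rewrite big_distrr.
by apply: eq_bigr => k _ /=; rewrite mulnCA.
Qed.

Section Counts.
Variables (j a b c : nat).
Let N := (3 * j).+3.

(** The diagonal degree complementary to off-diagonal degrees of sum s; the term 3 keeps the weight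
    t - 3, which may be negative, a natural number. *)
Definition diag_count (t s : nat) : nat := msum N (fun k => (2 * k + s + 3 == 2 * j + t)%N).

Lemma diag_count_small t s : t <= 5 -> 2 * j + 2 < s -> diag_count t s = 0.
Proof.
move=> t5 js; rewrite /diag_count /msum big1 // => k _.
by rewrite (_ : (_ == _) = false) ?muln0 //; lia.
Qed.

Definition offdiag_count k1 k2 k4 : nat :=
  diag_count a (k1 + k2) * diag_count b (k1 + k4) * diag_count c (k2 + k4).

Lemma msum_offdiag :
  msum N (fun k0 => msum N (fun k1 => msum N (fun k2 => msum N (fun k3 => msum N (fun k4 =>
    msum N (fun k5 => [&& 2 * k0 + k1 + k2 + 3 == 2 * j + a, k1 + 2 * k3 + k4 + 3 == 2 * j + b
      & k2 + k4 + 2 * k5 + 3 == 2 * j + c]%N)))))) =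
  msum N (fun k1 => msum N (fun k2 => msum N (fun k4 => offdiag_count k1 k2 k4))).
Proof.
pose A k0 k1 k2 : nat := (2 * k0 + (k1 + k2) + 3 == 2 * j + a).
pose B k3 k1 k4 : nat := (2 * k3 + (k1 + k4) + 3 == 2 * j + b).
pose C k5 k2 k4 : nat := (2 * k5 + (k2 + k4) + 3 == 2 * j + c).
transitivity (msum N (fun k0 => msum N (fun k1 => msum N (fun k2 => msum N (fun k4 =>
    A k0 k1 k2 * (diag_count b (k1 + k4) * diag_count c (k2 + k4))))))).
  apply: eq_msum => k0; apply: eq_msum => k1; apply: eq_msum => k2.
  rewrite exchange_msum; apply: eq_msum => k4.
  transitivity (msum N (fun k3 => A k0 k1 k2 * diag_count c (k2 + k4) * B k3 k1 k4)).
    apply: eq_msum => k3; rewrite mulnAC /diag_count -msumZ; apply: eq_msum => k5.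
    by rewrite /A /B !mulnb; congr nat_of_bool; lia.
  by rewrite msumZ -mulnA [diag_count c _ * _]mulnC.
rewrite exchange_msum; apply: eq_msum => k1.
rewrite exchange_msum; apply: eq_msum => k2.
rewrite exchange_msum; apply: eq_msum => k4.
rewrite /offdiag_count -mulnA [RHS]mulnC [diag_count a _]/diag_count -msumZ.
apply: eq_msum => k0.
by rewrite mulnC.
Qed.

Lemma msum_parity F M : (forall k, 2 * j + 2 < k -> F k = 0) -> 2 * j + 2 < M.*2 ->
  msum N F = \sum_(e < 2) \sum_(x < M) mult (2 * x + e) * F (2 * x + e).
Proof.
move=> F0 jM.
have cut m : 2 * j + 2 < m -> msum m F = msum (2 * j).+3 F.
  move=> jm; rewrite /msum -!(big_mkord xpredT (fun k => mult k * F k)).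
  rewrite (big_cat_nat _ (n := (2 * j).+3)) //=; last by lia.
  rewrite [X in _ + X = _]big1_seq ?addn0 // => k.
  by rewrite mem_index_iota => /andP[_ /andP[jk _]]; rewrite F0 ?muln0 //; lia.
have jN : 2 * j + 2 < N by rewrite /N; lia.
rewrite (cut N jN) -(cut _ jM) exchange_big /msum.
elim: (M) => [|m IHm]; first by rewrite !big_ord0.
rewrite doubleS 2!big_ord_recr /= IHm [RHS]big_ord_recr /= -addnA; congr (_ + _).
by rewrite !big_ord_recl big_ord0 /= /bump /= mul2n !addn0 addn1.
Qed.

Definition parity_count M e1 e2 e3 : nat :=
  \sum_(x < M) \sum_(y < M) \sum_(z < M)
    mult (2 * x + e1) * mult (2 * y + e2) * mult (2 * z + e3) *
    offdiag_count (2 * x + e1) (2 * y + e2) (2 * z + e3).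

Lemma offdiag_parity M : a <= 5 -> b <= 5 -> c <= 5 -> 2 * j + 2 < M.*2 ->
  msum N (fun k1 => msum N (fun k2 => msum N (fun k4 => offdiag_count k1 k2 k4))) =
  \sum_(e1 < 2) \sum_(e2 < 2) \sum_(e3 < 2) parity_count M e1 e2 e3.
Proof.
move=> a5 b5 c5 jM.
have z1 k1 k2 k4 : 2 * j + 2 < k1 -> offdiag_count k1 k2 k4 = 0.
  by move=> jk; rewrite /offdiag_count diag_count_small // ltn_addr.
have z2 k1 k2 k4 : 2 * j + 2 < k2 -> offdiag_count k1 k2 k4 = 0.
  by move=> jk; rewrite /offdiag_count diag_count_small // ltn_addl.
have z4 k1 k2 k4 : 2 * j + 2 < k4 -> offdiag_count k1 k2 k4 = 0.
  by move=> jk; rewrite /offdiag_count [diag_count b _]diag_count_small ?muln0 // ltn_addl.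
have m0 F : (forall k, F k = 0) -> msum N F = 0.
  by move=> F0; rewrite /msum big1 // => k _; rewrite F0 muln0.
rewrite (msum_parity (M := M)) // => [|k1 jk]; last first.
  by apply: (m0) => k2; apply: (m0) => k4; apply: z1.
apply: eq_bigr => e1 _.
transitivity (\sum_(x < M) \sum_(e2 < 2) \sum_(e3 < 2) \sum_(y < M) \sum_(z < M)
    mult (2 * x + e1) * mult (2 * y + e2) * mult (2 * z + e3) *
    offdiag_count (2 * x + e1) (2 * y + e2) (2 * z + e3)).
  apply: eq_bigr => x _; rewrite (msum_parity (M := M)) // => [|k2 jk]; last first.
    by apply: m0 => k4; apply: z2.
  rewrite big_distrr; apply: eq_bigr => e2 _ /=; rewrite exchange_big big_distrr /=.
  apply: eq_bigr => y _; rewrite (msum_parity (M := M)) // => [|k4 jk]; last exact: z4.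
  rewrite !big_distrr; apply: eq_bigr => e3 _ /=; rewrite !big_distrr /=.
  by apply: eq_bigr => z _; rewrite !mulnA.
rewrite exchange_big; apply: eq_bigr => e2 _; rewrite exchange_big; apply: eq_bigr => e3 _.
by [].
Qed.

Lemma diag_count_odd t s : odd (s + t).+1 -> diag_count t s = 0.
Proof.
move=> st; rewrite /diag_count /msum big1 // => k _.
by rewrite (_ : (_ == _) = false) ?muln0 //; lia.
Qed.

(** The sum of the two off-diagonal degrees at an index has the parity of the weight. *)
Lemma parity_count0 M e1 e2 e3 :
    [|| odd (a + e1 + e2).+1, odd (b + e1 + e3).+1 | odd (c + e2 + e3).+1] ->
  parity_count M e1 e2 e3 = 0.
Proof.
move=> par; rewrite /parity_count big1 // => x _; rewrite big1 // => y _.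
rewrite big1 // => z _; rewrite /offdiag_count.
case/or3P: par => par; [rewrite [diag_count a _]diag_count_odd
  | rewrite [diag_count b _]diag_count_odd | rewrite [diag_count c _]diag_count_odd];
  rewrite ?mul0n ?muln0 ?mul0n ?muln0 //; move: par; clear; lia.
Qed.

(** At most one diagonal degree contributes, J - u - d; when it is -1 or -2 the binomial coefficient in
    [tmult] vanishes. *)
Lemma diag_count_block t d e J u : 2 * J + 3 + e = 2 * j + t + 2 * d -> d <= 2 -> J <= j.+1 ->
  diag_count t (2 * u + e) = if u <= J then tmult d (J - u) else 0.
Proof.
move=> Je d2 Jj; rewrite /diag_count /msum.
have cond k : (2 * k + (2 * u + e) + 3 == 2 * j + t) = (k + u + d == J).
  by move: Je; clear; lia.
under eq_bigr => k _ do rewrite cond.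
have [udJ|Jud] := leqP (u + d) J.
  have kN : J - u - d < N by rewrite /N; move: Jj; clear; lia.
  rewrite (bigD1 (Ordinal kN)) //= big1 ?addn0 => [|k kn].
    have -> : (J - u - d + u + d == J) by lia.
    rewrite muln1 ifT; last by lia.
    by rewrite /mult /tmult; congr 'C(_, _); lia.
  rewrite (_ : (_ == J) = false) ?muln0 //; apply: contraNF kn => /eqP kE.
  by apply/eqP/val_inj; rewrite /= -kE; lia.
rewrite big1 => [|k _]; last first.
  by rewrite (_ : (_ == J) = false) ?muln0 //; move: Jud; clear; lia.
by case: ifP => // uJ; rewrite /tmult bin_small //; lia.
Qed.

Lemma parity_count_block M e1 e2 e3 d1 d2 d3 J :
    2 * J + 3 + (e1 + e2) = 2 * j + a + 2 * d1 ->
    2 * J + 3 + (e1 + e3) = 2 * j + b + 2 * d2 ->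
    2 * J + 3 + (e2 + e3) = 2 * j + c + 2 * d3 ->
    [&& d1 <= 2, d2 <= 2 & d3 <= 2] -> J <= j.+1 -> J < M ->
  parity_count M e1 e2 e3 = block e1 e2 e3 d1 d2 d3 J.
Proof.
move=> Ja Jb Jc /and3P[h1 h2 h3] Jj JM.
pose T (x y z : nat) := if region x y z J then
  blockW e1 e2 e3 d1 d2 d3 x y z (J - x - y) (J - x - z) (J - y - z) else 0.
transitivity (\sum_(x < M) \sum_(y < M) \sum_(z < M) T x y z).
  apply: eq_bigr => x _; apply: eq_bigr => y _; apply: eq_bigr => z _.
  rewrite /offdiag_count /T /region /blockW.
  rewrite (_ : 2 * x + e1 + (2 * y + e2) = 2 * (x + y) + (e1 + e2)); last by lia.
  rewrite (_ : 2 * x + e1 + (2 * z + e3) = 2 * (x + z) + (e1 + e3)); last by lia.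
  rewrite (_ : 2 * y + e2 + (2 * z + e3) = 2 * (y + z) + (e2 + e3)); last by lia.
  rewrite (diag_count_block _ Ja) // (diag_count_block _ Jb) // (diag_count_block _ Jc) //.
  by case: (_ <= J); case: (_ <= J); case: (_ <= J); rewrite ?muln0 ?mul0n ?muln0 //= !subnDA.
have cut (F : nat -> nat) : (forall k, J < k -> F k = 0) ->
    \sum_(k < M) F k = \sum_(k < J.+1) F k.
  move=> F0; rewrite -!(big_mkord xpredT F) (big_cat_nat _ (n := J.+1)) //=.
  rewrite [X in _ + X = _]big1_seq ?addn0 // => k.
  by rewrite mem_index_iota => /andP[_ /andP[/F0]].
have T0 x y z : (J < x) || (J < y) || (J < z) -> T x y z = 0.
  by rewrite /T /region => H; rewrite ifF //; move: H; clear; lia.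
rewrite /block (cut (fun x => \sum_(y < M) \sum_(z < M) T x y z)) => [|k Jk]; last first.
  by rewrite big1 // => y _; rewrite big1 // => z _; rewrite T0 // Jk.
apply: eq_bigr => x _.
rewrite (cut (fun y => \sum_(z < M) T x y z)) => [|k Jk]; last first.
  by rewrite big1 // => z _; rewrite T0 // Jk orbT.
apply: eq_bigr => y _; rewrite (cut (T x y)) => [|k Jk]; last by rewrite T0 // Jk !orbT.
by rewrite [RHS]big_mkcond.
Qed.
End Counts.

(** The dimension of the space of weight (a - 3, b - 3, c - 3) relative to (2 j, 2 j, 2 j) in degree
    3 j. The variables are the degrees in the entries 00, 01, 02, 11, 12, 22. *)
Definition weight_count (j a b c : nat) : nat :=
  let N := (3 * j).+3 in
  msum N (fun k0 => msum N (fun k1 => msum N (fun k2 => msum N (fun k3 => msum N (fun k4 =>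
    msum N (fun k5 => [&& 2 * k0 + k1 + k2 + 3 == 2 * j + a, k1 + 2 * k3 + k4 + 3 == 2 * j + b
      & k2 + k4 + 2 * k5 + 3 == 2 * j + c]%N)))))).

Lemma weight_count_parity j a b c : a <= 5 -> b <= 5 -> c <= 5 ->
  weight_count j a b c =
    parity_count j a b c j.+2 0 0 0 + parity_count j a b c j.+2 1 1 1
    + (parity_count j a b c j.+2 0 0 1 + parity_count j a b c j.+2 1 1 0)
    + (parity_count j a b c j.+2 0 1 0 + parity_count j a b c j.+2 1 0 1)
    + (parity_count j a b c j.+2 1 0 0 + parity_count j a b c j.+2 0 1 1).
Proof.
move=> a5 b5 c5; have jM : 2 * j + 2 < j.+2.*2 by lia.
rewrite [LHS](etrans (msum_offdiag j a b c) (offdiag_parity a5 b5 c5 jM)).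
rewrite !big_ord_recl !big_ord0 /= /bump /= !addn0; lia.
Qed.

(** For given weight, two of the eight choices of parities are possible. Each of the three conditions
    bounds a sum of two of x, y, z; the largest bound, but at least j, is the J of the block. *)
Lemma weight_counts j :
  [/\ weight_count j 3 3 3 = block 0 0 0 0 0 0 j + block 1 1 1 1 1 1 j,
      weight_count j 5 2 2 = block 0 0 1 0 2 2 j.+1 + block 1 1 0 0 1 1 j &
      weight_count j 4 4 1 = block 1 0 0 0 0 1 j + block 0 1 1 0 0 2 j] /\
  [/\ weight_count j 4 2 3 = block 1 0 0 0 1 0 j + block 0 1 1 0 1 1 j,
      weight_count j 4 3 2 = block 0 1 0 0 0 1 j + block 1 0 1 0 1 1 j &
      weight_count j 5 3 1 = block 0 0 0 0 1 2 j.+1 + block 1 1 1 0 1 2 j].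
Proof.
have JM0 : j < j.+2 by lia.
have J0 : j <= j.+1 by lia.
split; split; rewrite weight_count_parity //.
- rewrite (@parity_count_block _ _ _ _ _ 0 0 0 0 0 0 j) //; try lia.
  rewrite (@parity_count_block _ _ _ _ _ 1 1 1 1 1 1 j) //; try lia.
  by rewrite !parity_count0 // !addn0.
- rewrite (@parity_count_block _ _ _ _ _ 0 0 1 0 2 2 j.+1) //; try lia.
  rewrite (@parity_count_block _ _ _ _ _ 1 1 0 0 1 1 j) //; try lia.
  by rewrite !parity_count0 // !addn0.
- rewrite (@parity_count_block _ _ _ _ _ 1 0 0 0 0 1 j) //; try lia.
  rewrite (@parity_count_block _ _ _ _ _ 0 1 1 0 0 2 j) //; try lia.
  by rewrite !parity_count0 // !addn0.
- rewrite (@parity_count_block _ _ _ _ _ 1 0 0 0 1 0 j) //; try lia.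
  rewrite (@parity_count_block _ _ _ _ _ 0 1 1 0 1 1 j) //; try lia.
  by rewrite !parity_count0 // !addn0.
- rewrite (@parity_count_block _ _ _ _ _ 0 1 0 0 0 1 j) //; try lia.
  rewrite (@parity_count_block _ _ _ _ _ 1 0 1 0 1 1 j) //; try lia.
  by rewrite !parity_count0 // !addn0.
rewrite (@parity_count_block _ _ _ _ _ 0 0 0 0 1 2 j.+1) //; try lia.
rewrite (@parity_count_block _ _ _ _ _ 1 1 1 0 1 2 j) //; try lia.
by rewrite !parity_count0 // !addn0.
Qed.
End DegreeCounts.

(** * Monomials of given weight *)

(** Exponents of the three copies of an entry, and of the six entries. *)
Notation expo3 N := ('I_N * 'I_N * 'I_N)%type.
Notation expo N := (expo3 N * expo3 N * expo3 N * expo3 N * expo3 N * expo3 N)%type.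

Section Counting.
Variable N : nat.

Definition expo3_of (p : expo3 N) (c : 'I_3) : nat :=
  nth 0%N [:: val p.1.1; val p.1.2; val p.2] c.
Definition sum3 (p : expo3 N) : nat := (p.1.1 + p.1.2 + p.2)%N.

Definition row_of (t : expo N) (e : 'I_6) : expo3 N :=
  let: (p0, p1, p2, p3, p4, p5) := t in nth p0 [:: p0; p1; p2; p3; p4; p5] e.

Definition monom_of (t : expo N) : 'X_{1..18} :=
  [multinom (mxvec (\matrix_(c < 3, e < 6) expo3_of (row_of t e) c) : 'rV[nat]_18) ord0 k
   | k < 18].

Lemma monom_ofE t (c : 'I_3) (e : 'I_6) :
  monom_of t (mxvec_index c e) = expo3_of (row_of t e) c.
Proof. by rewrite mnmE; apply: etrans (mxvecE _ _ _) _; rewrite mxE. Qed.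

Lemma expo3_of_inj p q : expo3_of p =1 expo3_of q -> p = q.
Proof.
case: p q => [[a b] c] [[a' b'] c'] pq.
by have := pq o0; have := pq o1; have := pq o2; rewrite /expo3_of /= => /val_inj -> /val_inj -> /val_inj ->.
Qed.

Lemma monom_of_inj : injective monom_of.
Proof.
move=> t u tu; have rE e : row_of t e = row_of u e.
  by apply: expo3_of_inj => c; rewrite -!monom_ofE tu.
case: t u {tu} rE => [[[[[p0 p1] p2] p3] p4] p5] [[[[[q0 q1] q2] q3] q4] q5] rE.
have := rE (@Ordinal 6 0 isT); have := rE (@Ordinal 6 1 isT).
have := rE (@Ordinal 6 2 isT); have := rE (@Ordinal 6 3 isT).
by have := rE (@Ordinal 6 4 isT); have := rE (@Ordinal 6 5 isT) => /= -> -> -> -> -> ->.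
Qed.

Lemma expo3_of_surj (f : 'I_3 -> nat) : (forall c, (f c < N)%N) ->
  exists p : expo3 N, expo3_of p =1 f.
Proof.
move=> fN; exists (Ordinal (fN o0), Ordinal (fN o1), Ordinal (fN o2)).
by case=> [[|[|[|//]]] lt]; congr f; apply: val_inj.
Qed.

Lemma monom_of_surj (m : 'X_{1..18}) : (forall k, (m k < N)%N) ->
  exists t, m = monom_of t.
Proof.
move=> mN; have row (e : 'I_6) : exists p : expo3 N, forall c, expo3_of p c = m (mxvec_index c e).
  exact: expo3_of_surj.
have [p0 h0] := row (@Ordinal 6 0 isT); have [p1 h1] := row (@Ordinal 6 1 isT).
have [p2 h2] := row (@Ordinal 6 2 isT); have [p3 h3] := row (@Ordinal 6 3 isT).
have [p4 h4] := row (@Ordinal 6 4 isT); have [p5 h5] := row (@Ordinal 6 5 isT).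
exists (p0, p1, p2, p3, p4, p5); apply/mnmP => k.
case/(@mxvec_indexP 3 6): k => c e; rewrite monom_ofE.
case: e => [[|[|[|[|[|[|//]]]]]] lt] /=; [rewrite h0|rewrite h1|rewrite h2|rewrite h3|rewrite h4|rewrite h5];
  by apply: (congr1 (fun e : 'I_6 => m (mxvec_index c e))); apply: val_inj.
Qed.

Definition row_sum (t : expo N) (e : 'I_6) : nat := sum3 (row_of t e).

Lemma sum_expo3 p : (\sum_(c < 3) expo3_of p c = sum3 p)%N.
Proof. by rewrite !big_ord_recl big_ord0 /expo3_of /sum3 /= addn0 addnA. Qed.

Definition wt_of (t : expo N) (i : 'I_3) : nat :=
  let: (p0, p1, p2, p3, p4, p5) := t in
  nth 0%N [:: 2 * sum3 p0 + sum3 p1 + sum3 p2; sum3 p1 + 2 * sum3 p3 + sum3 p4;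
     sum3 p2 + sum3 p4 + 2 * sum3 p5]%N i.

Lemma mwt_monom t i : mwt i (monom_of t) = wt_of t i.
Proof.
rewrite /mwt exchange_big /=.
under eq_bigr => e _.
  under eq_bigr => c _ do rewrite monom_ofE.
  rewrite -big_distrr sum_expo3 /=.
  over.
case: t => [[[[[p0 p1] p2] p3] p4] p5].
rewrite !big_ord_recl big_ord0 /ewt /sym_entry /row_of /=.
rewrite -!val_eqE /= !inordK //.
by case: i => [[|[|[|//]]] lt] /=; lia.
Qed.
Lemma sum_convol (a F : nat -> nat) : (forall k, (N <= k)%N -> F k = 0%N) ->
  (\sum_(i < N) \sum_(j < N) a i * F (i + j) =
   \sum_(k < N) (\sum_(i < k.+1) a i) * F k)%N.
Proof.
move=> F0.
have shift (i : 'I_N) : (\sum_(j < N) a i * F (i + j) = \sum_(k < N | i <= k) a i * F k)%N.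
  rewrite -(big_mkord xpredT (fun j => a i * F (i + j))%N) /=.
  rewrite -(big_mkord (fun k => (i <= k)%N) (fun k => a i * F k)%N) /=.
  rewrite -[RHS](big_nat_widenl _ _ _ predT) //.
  rewrite (big_addn 0 N i) /= (big_cat_nat _ (n := (N - i)%N)) ?leq_subr //=.
  rewrite [X in (_ + X)%N]big1_seq ?addn0.
    by apply: eq_bigr => k _; rewrite addnC.
  move=> k /=; rewrite mem_index_iota => /andP[Nk _].
  by rewrite F0 ?muln0 // -leq_subLR.
under eq_bigr => i _ do rewrite shift.
rewrite (exchange_big_dep xpredT) //=; apply: eq_bigr => k _.
rewrite -big_distrl /=; congr (_ * _)%N.
by rewrite (big_ord_widen N a).
Qed.

(** There are [mult k] exponent triples of sum k. Since F vanishes from N on, the bound on the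
    exponents does not matter. *)
Lemma sum_sum3 (F : nat -> nat) : (forall k, (N <= k)%N -> F k = 0%N) ->
  (\sum_(p : expo3 N) F (sum3 p) = msum N F)%N.
Proof.
move=> F0; rewrite /sum3 /msum.
rewrite -(pair_bigA _ (fun (ab : 'I_N * 'I_N) (c : 'I_N) => F (ab.1 + ab.2 + c)%N)) /=.
rewrite -(pair_bigA _ (fun a b : 'I_N => \sum_(c < N) F (a + b + c))%N) /=.
pose G s := (\sum_(c < N) F (s + c))%N.
have G0 s : (N <= s)%N -> G s = 0%N.
  by move=> Ns; rewrite /G big1 // => c _; rewrite F0 // (leq_trans Ns) ?leq_addr.
transitivity (\sum_(i < N) \sum_(j < N) 1 * G (i + j))%N.
  by apply: eq_bigr => i _; apply: eq_bigr => j _; rewrite mul1n.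
rewrite (sum_convol (fun=> 1%N) G0) /G.
transitivity (\sum_(k < N) \sum_(c < N) k.+1 * F (k + c))%N.
  by apply: eq_bigr => k _; rewrite big_const_ord iter_addn_0 mul1n big_distrr.
rewrite (sum_convol S F0); apply: eq_bigr => k _; congr (_ * _)%N.
rewrite /mult; elim: (val k) => [|m IHm]; first by rewrite big_ord_recl big_ord0.
by rewrite big_ord_recr /= IHm [RHS]binS bin1 addnC.
Qed.

Lemma sum_expo (G : nat -> nat -> nat -> nat -> nat -> nat -> nat) :
    (forall s0 s1 s2 s3 s4 s5, ~~ [&& s0 < N, s1 < N, s2 < N, s3 < N, s4 < N & s5 < N]%N ->
      G s0 s1 s2 s3 s4 s5 = 0%N) ->
  (\sum_(t : expo N) G (row_sum t (@Ordinal 6 0 isT)) (row_sum t (@Ordinal 6 1 isT))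
     (row_sum t (@Ordinal 6 2 isT)) (row_sum t (@Ordinal 6 3 isT))
     (row_sum t (@Ordinal 6 4 isT)) (row_sum t (@Ordinal 6 5 isT)) =
   msum N (fun k0 => msum N (fun k1 => msum N (fun k2 => msum N (fun k3 => msum N (fun k4 =>
     msum N (fun k5 => G k0 k1 k2 k3 k4 k5)))))))%N.
Proof.
move=> G0.
transitivity (\sum_(p0 : expo3 N) \sum_(p1 : expo3 N) \sum_(p2 : expo3 N)
    \sum_(p3 : expo3 N) \sum_(p4 : expo3 N) \sum_(p5 : expo3 N)
    G (sum3 p0) (sum3 p1) (sum3 p2) (sum3 p3) (sum3 p4) (sum3 p5))%N.
  by rewrite !pair_bigA; apply: eq_bigr => - [[[[[p0 p1] p2] p3] p4] p5] _.
rewrite (sum_sum3 (F := fun s0 => \sum_p1 \sum_p2 \sum_p3 \sum_p4 \sum_p5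
    G s0 (sum3 p1) (sum3 p2) (sum3 p3) (sum3 p4) (sum3 p5))%N) => [|s Ns]; last first.
  by do 5!(rewrite big1 // => ? _); rewrite G0 // ltnNge Ns ?andbF.
apply: eq_msum => k0.
rewrite (sum_sum3 (F := fun s1 => \sum_p2 \sum_p3 \sum_p4 \sum_p5
    G k0 s1 (sum3 p2) (sum3 p3) (sum3 p4) (sum3 p5))%N) => [|s Ns]; last first.
  by do 4!(rewrite big1 // => ? _); rewrite G0 // [(s < N)%N]ltnNge Ns ?andbF.
apply: eq_msum => k1.
rewrite (sum_sum3 (F := fun s2 => \sum_p3 \sum_p4 \sum_p5
    G k0 k1 s2 (sum3 p3) (sum3 p4) (sum3 p5))%N) => [|s Ns]; last first.
  by do 3!(rewrite big1 // => ? _); rewrite G0 // [(s < N)%N]ltnNge Ns ?andbF.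
apply: eq_msum => k2.
rewrite (sum_sum3 (F := fun s3 => \sum_p4 \sum_p5
    G k0 k1 k2 s3 (sum3 p4) (sum3 p5))%N) => [|s Ns]; last first.
  by do 2!(rewrite big1 // => ? _); rewrite G0 // [(s < N)%N]ltnNge Ns ?andbF.
apply: eq_msum => k3.
rewrite (sum_sum3 (F := fun s4 => \sum_p5 G k0 k1 k2 k3 s4 (sum3 p5))%N) => [|s Ns]; last first.
  by rewrite big1 // => ? _; rewrite G0 // [(s < N)%N]ltnNge Ns ?andbF.
apply: eq_msum => k4.
rewrite (sum_sum3 (F := fun s5 => G k0 k1 k2 k3 k4 s5)) // => s Ns.
by rewrite G0 // [(s < N)%N]ltnNge Ns ?andbF.
Qed.
Lemma sum_wt_of t : (wt_of t o0 + wt_of t o1 + wt_of t o2 = 2 * mdeg (monom_of t))%N.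
Proof. by rewrite -!mwt_monom mwt_sum. Qed.

Lemma wt_of_row_sum t : [/\
  wt_of t o0 = 2 * row_sum t (@Ordinal 6 0 isT) + row_sum t (@Ordinal 6 1 isT)
               + row_sum t (@Ordinal 6 2 isT),
  wt_of t o1 = row_sum t (@Ordinal 6 1 isT) + 2 * row_sum t (@Ordinal 6 3 isT)
               + row_sum t (@Ordinal 6 4 isT) &
  wt_of t o2 = row_sum t (@Ordinal 6 2 isT) + row_sum t (@Ordinal 6 4 isT)
               + 2 * row_sum t (@Ordinal 6 5 isT)]%N.
Proof. by case: t => [[[[[p0 p1] p2] p3] p4] p5]. Qed.
End Counting.

Section MonomialBasis.
Variables (K : fieldType) (k n : nat) (A : finType) (mon : A -> 'X_{1..k.+1}).
Local Notation W := (dhomog k.+1 K n).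

Definition mon_coefs (p : W) : 'rV[K]_#|A| :=
  \row_i (mpoly_of_dhomog p)@_(mon (enum_val i)).

Lemma mon_coefs_is_linear : linear mon_coefs.
Proof.
move=> a p q; apply/rowP => i; rewrite !mxE -mcoeffZ -mcoeffD.
by congr mcoeff; apply: mpoly_of_dhomog_is_linear.
Qed.
HB.instance Definition _ := GRing.isLinear.Build K W 'rV[K]_#|A| _ mon_coefs
  mon_coefs_is_linear.

(** The coefficients at the monomials in question are coordinates on [U]. *)
Lemma dim_monomials (U : {vspace W}) :
    injective mon -> (forall a, mdeg (mon a) = n) ->
    (forall p, p \in U <-> (forall m, m \in msupp (mpoly_of_dhomog p) -> exists a, m = mon a)) ->
  \dim U = #|A|.
Proof.
move=> mon_inj mon_deg UP; pose F := linfun mon_coefs.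
have <- : \dim (F @: U) = \dim U.
  apply: limg_dim_eq; apply/eqP; rewrite -subv0; apply/subvP => p.
  rewrite memv0 => /memv_capP[/UP Up]; rewrite memv_ker lfunE => /eqP/rowP p0.
  apply/eqP/val_inj/mpolyP => m; rewrite [RHS]mcoeff0.
  apply/eqP; apply: contraTT isT; rewrite -mcoeff_msupp => mp.
  have [a am] := Up _ mp; have := p0 (enum_rank a); rewrite !mxE enum_rankK -am => /eqP.
  by rewrite -[_ == 0]negbK -mcoeff_msupp mp.
suff -> : (F @: U)%VS = fullv by rewrite dimvf dim_matrix; apply: mul1n.
apply/vspaceP => r; rewrite memvf; apply/memv_imgP.
have hom : \sum_i r ord0 i *: 'X_[mon (enum_val i)] \is n.-homog.
  by apply: rpred_sum => i _; apply: rpredZ; rewrite dhomogX /= mon_deg.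
have coef m : (\sum_i r ord0 i *: 'X_[mon (enum_val i)])@_m =
    \sum_i r ord0 i * (mon (enum_val i) == m)%:R.
  by rewrite (raddf_sum (mcoeff m)); apply: eq_bigr => i _; rewrite /= mcoeffZ mcoeffX.
exists (DHomog hom).
  apply/UP => m; rewrite mcoeff_msupp coef => nz.
  have [i /eqP mi|none] := pickP (fun i : 'I_#|A| => mon (enum_val i) == m); first by exists (enum_val i).
  by move: nz; rewrite big1 ?eqxx // => i _; rewrite none mulr0.
rewrite lfunE; apply/rowP => i; rewrite mxE coef (bigD1 i) //= eqxx mulr1 big1 ?addr0 //.
move=> l /negPf li; rewrite (inj_eq mon_inj) (inj_eq enum_val_inj) li mulr0 //.
Qed.
End MonomialBasis.

Section WeightCount.
Variables (n a b c : nat).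

(** The weights are compared after multiplication by 3, as the mean weight is 2 n / 3, and shifted
    by 3 to be natural numbers. *)
Definition weight_cond (u v w : nat) :=
  [&& 3 * u + 9 == 2 * n + 3 * a, 3 * v + 9 == 2 * n + 3 * b & 3 * w + 9 == 2 * n + 3 * c]%N.

Definition weight_monoms : {set expo n.+3} :=
  [set t | weight_cond (wt_of t o0) (wt_of t o1) (wt_of t o2)].

Hypothesis abc : (a + b + c = 9)%N.

Lemma dim_weight_space (K : numFieldType) :
  \dim (weight_space (gl_end K n) (wt K (a%:Z - 3) (b%:Z - 3) (c%:Z - 3))) = #|weight_monoms|.
Proof.
rewrite -card_sig.
apply: (@dim_monomials _ _ _ _ (fun t : {t | t \in weight_monoms} => monom_of (val t))).
- by move=> t u /monom_of_inj/val_inj.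
- move=> [t /= tA]; move: (tA); rewrite inE => /and3P[h0 h1 h2].
  have := sum_wt_of t; lia.
have E (u x : nat) : (u%:R = (x%:Z - 3)%:~R + mean_weight K n :> K) <->
    (3 * u + 9 == 2 * n + 3 * x)%N.
  have -> : (x%:Z - 3)%:~R = x%:R - 3 :> K by rewrite intrB.
  rewrite -(eqr_nat K) 2!natrD 3!natrM /mean_weight natrM.
  split=> [-> | /eqP H]; first by apply/eqP; field.
  apply: (@mulfI _ (3 : K)); first by rewrite pnatr_eq0.
  by apply: (@addIr _ 9); rewrite H; field.
move=> p; split=> [/weight_spaceP wp m mp | H].
  have mdegm : mdeg m = n by apply: (dhomog_mf (dhomog_is_dhomog p)).
  have [k|t mt] := @monom_of_surj n.+3 m.
    apply: (@leq_ltn_trans n); last by lia.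
    by rewrite -[leqRHS]mdegm mdegE (bigD1 k) //= leq_addr.
  suff tA : t \in weight_monoms by exists (Sub t tA).
  by rewrite inE -!mwt_monom -mt; apply/and3P; split; apply/E;
    apply: ((gl_end_weight _ _ _).1 (wp _)).
have wH m : m \in msupp (mpoly_of_dhomog p) ->
    weight_cond (mwt o0 m) (mwt o1 m) (mwt o2 m).
  by move=> /H[[t tA] ->] /=; move: tA; rewrite inE !mwt_monom.
apply/weight_spaceP/has_wtP; split; apply/gl_end_weight => m /wH/and3P[h0 h1 h2]; exact/E.
Qed.

Lemma card_weight_monoms : #|weight_monoms| =
  msum n.+3 (fun k0 => msum n.+3 (fun k1 => msum n.+3 (fun k2 => msum n.+3 (fun k3 =>
    msum n.+3 (fun k4 => msum n.+3 (fun k5 =>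
      weight_cond (2 * k0 + k1 + k2) (k1 + 2 * k3 + k4) (k2 + k4 + 2 * k5))))))).
Proof.
rewrite -(@sum_expo n.+3 (fun k0 k1 k2 k3 k4 k5 =>
  weight_cond (2 * k0 + k1 + k2) (k1 + 2 * k3 + k4) (k2 + k4 + 2 * k5))).
  rewrite -sum1_card big_mkcond; apply: eq_bigr => t _; rewrite inE.
  by have [-> -> ->] := wt_of_row_sum t; case: weight_cond.
move=> s0 s1 s2 s3 s4 s5; case E: weight_cond => //; case/negP.
by case/and3P: E => h0 h1 h2; apply/and5P; split; [..|apply/andP; split]; lia.
Qed.
End WeightCount.

(** * Dimensions of the homogeneous components *)

Section Dimension.
Variable K : numFieldType.

Lemma A3_inv_space n : A3 K n = inv_space (gl_end K n).
Proof.
apply/vspaceP => p; apply/idP/inv_spaceP => [/mem_A3/SL3_invariant_gl_der Ip i j ji | Ip].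
  by apply: dhomog_inj; rewrite gl_endE eq_sym (negPf ji) mul0r scale0r subr0 Ip // dhomog0_val.
apply/mem_A3/SL3_invariant_gl_der => i j ji.
have := congr1 (@mpoly_of_dhomog _ _ _) (Ip i j ji).
by rewrite gl_endE eq_sym (negPf ji) mul0r scale0r subr0 dhomog0_val.
Qed.

Lemma dim_A3_weights n :
  let d a b c := #|weight_monoms n a b c| in
  (\dim (A3 K n) + d 4 2 3 + d 4 3 2 + d 5 3 1 = d 3 3 3 + d 5 2 2 + d 4 4 1)%N.
Proof.
have wd (x y z : int) (a b c : nat) : (a + b + c = 9)%N -> x = a%:Z - 3 -> y = b%:Z - 3 ->
    z = c%:Z - 3 -> weight_dim (gl_end K n) x y z = #|weight_monoms n a b c|.
  by move=> abc -> -> ->; apply: dim_weight_space.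
have subst6 A w1 w2 w3 w4 w5 w6 d1 d2 d3 d4 d5 d6 : (A + w1 + w2 + w3 = w4 + w5 + w6)%N ->
    w1 = d1 -> w2 = d2 -> w3 = d3 -> w4 = d4 -> w5 = d5 -> w6 = d6 ->
    (A + d1 + d2 + d3 = d4 + d5 + d6)%N.
  by move=> H <- <- <- <- <- <-.
rewrite A3_inv_space.
have H := dim_inv_space (@gl_end_comm K n) (@gl_end_bounded K n) (@gl_end_trace K n).
by apply: (subst6 _ _ _ _ _ _ _ _ _ _ _ _ _ H); apply: wd.
Qed.

Lemma card_weight_monoms_count j a b c : (a + b + c = 9)%N ->
  #|weight_monoms (3 * j) a b c| = weight_count j a b c.
Proof.
move=> abc; rewrite card_weight_monoms // /weight_count.
by do 6!(apply: eq_msum => ?); congr nat_of_bool; rewrite /weight_cond; clear; lia.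
Qed.

Lemma dim_A3_multiple j : \dim (A3 K (3 * j)) = hilbert_coef j.
Proof.
have := dim_A3_weights (3 * j); rewrite /= !card_weight_monoms_count //.
have [[-> -> ->] [-> -> ->]] := weight_counts j; have := blocks_identity j.
rewrite /plus_blocks /minus_blocks; lia.
Qed.

(** The monomials of an invariant have the weights 2 n / 3, which are not integers here. *)
Lemma dim_A3_other n : ~~ (3 %| n)%N -> \dim (A3 K n) = 0%N.
Proof.
move=> n3; have z a b c : #|weight_monoms n a b c| = 0%N.
  apply: eq_card0 => t; rewrite inE; apply: contraNF n3 => /and3P[h _ _].
  by move: h; clear; lia.
by have := dim_A3_weights n; rewrite /= !z !addn0.
Qed.
End Dimension.

(** * The Poincare series *)

Lemma fps_mul_polyr (F : fieldType) (b : fps F) (q : {poly F}) n :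
  fps_mul b (fps_of_poly q) n = (\poly_(i < n.+1) b i * q)`_n.
Proof. by rewrite coefM; apply: eq_bigr => i _; rewrite coef_poly ltn_ord. Qed.

Lemma fps_mul_polyl (F : fieldType) (b : fps F) (q : {poly F}) n :
  fps_mul (fps_of_poly q) b n = (q * \poly_(i < n.+1) b i)`_n.
Proof.
rewrite coefM; apply: eq_bigr => i _; rewrite coef_poly ifT //.
by rewrite ltnS leq_subr.
Qed.

(** The equations for the coefficients of an inverse are triangular. *)
Lemma fps_inv_unique (F : fieldType) (a b : fps F) : a 0%N != 0 ->
  (forall n, fps_mul b a n = (n == 0%N)%:R) -> forall n, fps_inv a n = b n.
Proof.
move=> a0 ba; have va n : fps_mul (fps_inv a) a n = (n == 0%N)%:R.
  by rewrite fps_mulVr // /fps_of_poly coef1.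
move=> n; have [k] := ubnP n; elim: k n => // k IHk n nk.
apply: (mulIf a0); have := va n; rewrite -ba /fps_mul !big_ord_recr /= subnn.
rewrite (eq_bigr (fun i : 'I_n => b i * a (n - i)%N)) => [|i _]; first by move/addrI.
by rewrite IHk // (leq_trans (ltn_ord i)).
Qed.

(** The coefficients of (1 - 'X^3)^-r. *)
Definition geom3 (r n : nat) : rat :=
  if r is r'.+1 then ((3 %| n) * 'C(n %/ 3 + r', r'))%N%:R else (n == 0%N)%:R.

Lemma geom3_rec r n : geom3 r.+1 n - (if (n < 3)%N then 0 else geom3 r.+1 (n - 3)) = geom3 r n.
Proof.
have [n3|n3] := ltnP n 3.
  by case: n n3 => [|[|[|]]] // _; case: r => [|r]; rewrite /geom3 ?div0n ?add0n ?binn subr0.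
have dv : (3 %| n - 3)%N = (3 %| n)%N by lia.
rewrite /geom3 dv; have [d3|d3] := boolP (3 %| n)%N; last first.
  by case: r => [|r]; rewrite ?mul0n subr0 ?mul0n //; case: n n3 {dv d3}.
have -> : (n %/ 3 = ((n - 3) %/ 3).+1)%N by lia.
set k := (_ %/ 3)%N; rewrite !mul1n; case: r => [|r].
  by rewrite !addn0 !bin0 subrr; case: n n3 {dv d3 k}.
rewrite (_ : k.+1 + r.+1 = (k + r.+1).+1)%N // binS natrD addrAC subrr add0r.
by rewrite mul1n addSnnS.
Qed.

Lemma geom3_inv r n :
  fps_mul (geom3 r) (fps_of_poly ((1 - 'X^3) ^+ r)) n = (n == 0%N)%:R.
Proof.
elim: r n => [|r IHr] n.
  rewrite fps_mul_polyr expr0 mulr1 coef_poly ltnSn //.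
rewrite fps_mul_polyr exprS mulrA -(IHr n) /fps_mul coefM; apply: eq_bigr => i _.
congr (_ * _); rewrite mulrBr mulr1 coefB coefMXn !coef_poly -(geom3_rec r) ltn_ord.
congr (_ - _); case: (ltnP i 3) => // i3; rewrite ifT //.
by rewrite (leq_ltn_trans (leq_subr _ _)).
Qed.

Theorem mainTheorem6 (R : realType) :
  poincare_series_A3 R[i] =
  fps_div (fps_of_poly (1 + 'X^6 + 'X^12)) (fps_of_poly ((1 - 'X^3) ^+ 10)).
Proof.
apply/funext => n; rewrite /poincare_series_A3 /fps_div fps_mul_polyl.
have inv k : fps_inv (fps_of_poly ((1 - 'X^3) ^+ 10)) k = geom3 10 k.
  apply: fps_inv_unique; last exact: geom3_inv.
  rewrite /fps_of_poly -horner_coef0 horner_exp hornerD hornerN hornerC hornerXn expr0n.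
  by rewrite subr0 expr1n oner_neq0.
rewrite !mulrDl mul1r !coefD !coefXnM !coef_poly !inv ltnSn.
have [/dvdnP[j nE]|n3] := boolP (3 %| n)%N.
  have {nE} -> : n = (3 * j)%N by rewrite nE mulnC.
  have shift k m : m = (3 * k)%N -> (k <= j)%N ->
      geom3 10 (3 * j - m) = 'C(j - k + 9, 9)%:R.
    move=> -> kj; have -> : (3 * j - 3 * k = (j - k) * 3)%N by lia.
    by rewrite /geom3 dvdn_mull // mulnK // mul1n.
  rewrite dim_A3_multiple /hilbert_coef !natrD; congr (_ + _ + _).
  - by rewrite -[(3 * j)%N]subn0 (shift 0%N) // subn0.
  - case: ifP => j6; first by rewrite bin_small //; lia.
    rewrite ifT; last by lia.
    by rewrite (shift 2%N) //; [congr ('C(_, _)%:R); lia | lia].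
  case: ifP => j12; first by rewrite bin_small //; lia.
  rewrite ifT; last by lia.
  by rewrite (shift 4%N) //; [congr ('C(_, _)%:R); lia | lia].
rewrite dim_A3_other //; have z m : ~~ (3 %| m)%N -> geom3 10 m = 0.
  by rewrite /geom3 => /negPf ->.
have t c : (3 %| c)%N ->
    (if (n < c)%N then 0 else if (n - c < n.+1)%N then geom3 10 (n - c) else 0) = 0.
  move=> c3; have [//|cn] := ltnP n c; rewrite z; first by case: ifP.
  by move: n3 c3 cn; clear; lia.
by rewrite z // !t.
Qed.
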